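(* Let $X$ be a semi-equivelar map on the torus, and let the vertices of $X$ form $m$ ${\rm Aut}(X)$-orbits. (a) If the type of $X$ is $[4^1,8^2]$ then $m\le 2$. (b) If the type of $X$ is $[3^4,6^1]$, $[3^1,4^1,6^1,4^1]$ or $[3^1,12^2]$ then $m\le 3$. (c) If the type of $X$ is $[4^1,6^1,12^1]$ then $m\le 6$.
   Context: Maps. A map $M$ on a surface $S$ is a locally finite cell decomposition of $S$ into vertices, edges and faces. All maps are polyhedral: every face is an $n$-gon for some integer $n\ge 3$ (a closed disc bounded by a cycle of $n$ distinct vertices and $n$ edges), and the intersection of two distinct faces is empty, a single vertex, or a single edge. An automorphism of $M$ is a permutation of the vertex set which (together with its inverse) sends edges to edges and faces to faces; ${\rm Aut}(M)$ is the group of automorphisms of $M$. Type. For a vertex $u$ of $M$, the faces containing $u$ form a cycle $C_u$ (the face-cycle at $u$), consecutive faces sharing an edge through $u$. $M$ is semi-equivelar of type $[p_1^{n_1},\dots,p_k^{n_k}]$ (integers $p_i\ge 3$, $n_i\ge 1$, with $p_i\ne p_{i+1}$, indices modulo $k$, when $k>1$) if at every vertex $u$ the cycle $C_u$ consists, in cyclic order (in one of the two directions), of $n_1$ consecutive $p_1$-gons, then $n_2$ consecutive $p_2$-gons, ..., then $n_k$ consecutive $p_k$-gons. $M$ is semi-equivelar if it is semi-equivelar of some type. *)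

(* Defs.v *)
From HB Require Import structures.
From mathcomp Require Import all_boot all_order all_algebra all_fingroup.

Set Implicit Arguments.
Unset Strict Implicit.
Unset Printing Implicit Defensive.

(** Maps are encoded combinatorially, by their vertices and the boundary cycles
    of their faces; the torus is the closed connected orientable surface with
    Euler characteristic 0.  The torus being compact, a locally finite map on it
    is finite, so vertices and faces form finite types. *)

Record face_system := FaceSystem {
  vertex : finType;
  face : finType;
  boundary : face -> seq vertex  (* read cyclically *)
}.
Arguments boundary {f} _.

Section FaceSystem.
Variable X : face_system.
Implicit Types (u v : vertex X) (f g : face X).

Definition face_vertices f : {set vertex X} := [set u in boundary f].

(** An edge is identified with the pair of its end points.  Nothing is lost: if
    two edges had the same ends, a face through one and a face through the other
    could not meet in a single edge. *)
Definition face_edges f : {set {set vertex X}} :=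
  [set [set u; next (boundary f) u] | u in boundary f].

Definition edges : {set {set vertex X}} := \bigcup_(f : face X) face_edges f.

Definition adjacent : rel (vertex X) := [rel u v | [set u; v] \in edges].

Definition share_edge_at u : rel (face X) :=
  [rel f g | [exists e in face_edges f :&: face_edges g, u \in e]].

(** A listing of the face-cycle at [u], from any starting face and in either
    direction. *)
Definition face_cycle u (c : seq (face X)) : Prop :=
  [/\ 2 < size c, uniq c, c =i [pred f | u \in boundary f]
    & path.cycle (share_edge_at u) c].

Definition connected_map : Prop :=
  0 < #|vertex X| /\ forall u v, connect adjacent u v.

(** Given an orientation [o] of the faces ([true] meaning that [boundary f] is to
    be read backwards), [directed_edge o f u v] says that [f] runs along its edge
    [{u, v}] from [u] to [v]. *)
Definition directed_edge (o : face X -> bool) f u v : bool :=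
  let c := if o f then rev (boundary f) else boundary f in
  (u \in c) && (next c u == v).

Definition orientable : Prop :=
  exists o : face X -> bool, forall f g u v,
    f != g -> ~~ (directed_edge o f u v && directed_edge o g u v).

Definition euler_char : int :=
  (#|vertex X|%:Z - #|edges|%:Z + #|face X|%:Z)%R.

Definition preserves_map (s : {perm vertex X}) : bool :=
  [forall e in edges, s @: e \in edges] &&
  [forall f, exists g, [set s @: (e : {set vertex X}) | e in face_edges f]
                       == face_edges g].

Definition Aut_map : {set {perm vertex X}} :=
  [set s | preserves_map s && preserves_map s^-1%g].

End FaceSystem.

(** Finite polyhedral maps on closed surfaces. *)
Record polyhedral_map := PolyhedralMap {
  map_faces :> face_system;
  face_polygon : forall f : face map_faces,
    2 < size (boundary f) /\ uniq (boundary f);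
  face_meet : forall f g : face map_faces, f != g ->
    let I := face_vertices f :&: face_vertices g in
    [\/ I = set0, exists u, I = [set u] | I \in face_edges f :&: face_edges g];
  edge_two_faces : forall e, e \in edges map_faces ->
    #|[set f : face map_faces | e \in face_edges f]| = 2;
  vertex_face_cycle : forall u : vertex map_faces, exists c, face_cycle u c
}.

Definition on_torus (X : polyhedral_map) : Prop :=
  [/\ connected_map X, orientable X & euler_char X = 0%R].

(** The type [p_1^n_1, ..., p_k^n_k] is the sequence of the pairs (p_i, n_i). *)
Definition vertex_type := seq (nat * nat).

Definition wf_type (t : vertex_type) : bool :=
  [&& t != [::], all [pred pn | (2 < pn.1) && (0 < pn.2)] t
    & (1 < size t) ==> path.cycle [rel x y | x.1 != y.1] t].

Definition polygons (t : vertex_type) : seq nat :=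
  flatten [seq nseq pn.2 pn.1 | pn <- t].

Definition semi_equivelar_of_type (X : polyhedral_map) (t : vertex_type) : Prop :=
  wf_type t /\
  forall u : vertex X, exists2 c, face_cycle u c &
    [seq size (boundary f) | f <- c] = polygons t.

Definition semi_equivelar (X : polyhedral_map) : Prop :=
  exists t, semi_equivelar_of_type X t.

Lemma preserves_map1 (X : face_system) : preserves_map (1%g : {perm vertex X}).
Proof.
have im1 (e : {set vertex X}) : (1%g : {perm vertex X}) @: e = e.
  by rewrite -[RHS]imset_id; apply: eq_imset => x; rewrite perm1.
apply/andP; split; first by apply/forall_inP => e; rewrite im1.
apply/forallP => f; apply/existsP; exists f; apply/eqP.
by rewrite (eq_imset _ im1) imset_id.
Qed.

Lemma preserves_mapM (X : face_system) (s t : {perm vertex X}) :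
  preserves_map s -> preserves_map t -> preserves_map (s * t)%g.
Proof.
have imM (e : {set vertex X}) : (s * t)%g @: e = t @: (s @: e).
  by rewrite -imset_comp; apply: eq_imset => x; rewrite permM.
move=> /andP[/forall_inP se /forallP sf] /andP[/forall_inP te /forallP tf].
apply/andP; split; first by apply/forall_inP => e /se/te; rewrite imM.
apply/forallP => f; have /existsP[g /eqP fg] := sf f.
have /existsP[h /eqP gh] := tf g; apply/existsP; exists h; apply/eqP.
by rewrite (eq_imset _ imM) -gh -fg -[RHS]imset_comp.
Qed.

Lemma group_set_Aut_map (X : face_system) : group_set (Aut_map X).
Proof.
apply/group_setP; split; first by rewrite inE invg1 preserves_map1.
move=> s t; rewrite !inE => /andP[s1 s2] /andP[t1 t2].
by rewrite invMg !preserves_mapM.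
Qed.

Canonical Aut_map_group (X : face_system) := Group (group_set_Aut_map X).

Definition vertex_orbits (X : face_system) : {set {set vertex X}} :=
  [set orbit 'P (Aut_map X) u | u : vertex X].

(* Main.v *)
(** The vertices of the maps of type [3^4,6], [3,4,6,4], [3,12^2] (resp. [4,8^2])
    carry a simply transitive action, on the universal cover, of the rotation
    group p6 (resp. p4); for [4,6,12] this holds for half of the vertices.  Here
    no universal cover is used: since the map is oriented, two rotations [x] and
    [z] are defined on the finite map itself, as words in the moves of corners.
    They satisfy the relations of p6 or p4, and no rotation about the centre of a
    face or the midpoint of an edge fixes a vertex.  Every element of p6 or p4 is
    a translation or has a nontrivial power conjugate to such a rotation, so all
    stabilisers consist of translations.  Translations and half-turns normalise
    them, hence induce automorphisms; they form a subgroup of index 3 in p6 and 2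
    in p4. *)

Require Import Defs.
From mathcomp Require Import all_boot all_order all_algebra all_fingroup.

Set Implicit Arguments.
Unset Strict Implicit.
Unset Printing Implicit Defensive.

(** * Plane rotation groups acting without fixed points *)

(** A map commuting with [x] and [z] and sending [e0] to [e] exists as soon as the stabiliser of
    [e0] fixes [e]. Translations commute and half-turns invert them, so both normalise every group
    of translations, whereas a rotation of order 3, 4 or 6 may move such a group. Modulo
    translations p6 and p4 are cyclic of orders 6 and 4; dividing by the half-turn leaves 3 and 2
    classes. For [4,6,12] each marked vertex brings an unmarked one, whence 6. Freeness need only be
    checked on a few rotations because conjugation by translations leaves few classes with a given
    angle: four of half-turns, three of rotations of order 3. Each is represented by a rotation
    about a face or an edge, which visibly moves a vertex. The delicate type is [3^4,6]: the
    polygons at a vertex do not tell which of the two middle triangles is the centre of a threefold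
    rotation. This choice must be shown to be the same everywhere before [z] is known to preserve
    the marked corners. *)

Section FreeRotations.
Local Open Scope group_scope.
Variable E : finType.
Implicit Types (g s t x z : {perm E}) (e : E).

Definition fixfree g := forall e, g e != e.

Lemma fixfreeJ g s : fixfree g -> fixfree (g ^ s).
Proof.
move=> gP e; rewrite conjgE !permM; apply/eqP => /(canRL (permK s)).
exact/eqP/gP.
Qed.

Lemma fixfreeX g n : fixfree (g ^+ n) -> fixfree g.
Proof.
move=> gP e; apply/eqP => ge; have /eqP[] := gP e.
by rewrite permX iter_fix.
Qed.

Lemma fixfreeV g : fixfree g -> fixfree g^-1.
Proof. by move=> gP e; apply/eqP => /(canRL (permKV g)) ge; have /eqP[] := gP e. Qed.

(** Any [g] carrying [e0] to [e] may serve to define [h e] as [g e1]; the condition on stabilisers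
    makes the result independent of [g]. *)
Lemma equivariant_map (G : {group {perm E}}) (e0 e1 : E) :
    (forall e, e \in orbit 'P G e0) ->
    (forall g, g \in G -> g e0 = e0 -> g e1 = e1) ->
  exists2 h : E -> E, h e0 = e1 & forall g e, g \in G -> h (g e) = g (h e).
Proof.
move=> trG stab.
have /fin_all_exists[w wP] e : exists g, g \in G /\ g e0 = e.
  by have /orbitP[g Gg ge] := trG e; exists g.
have same g g' : g \in G -> g' \in G -> g e0 = g' e0 -> g e1 = g' e1.
  move=> Gg Gg' gg'; have := stab (g * g'^-1).
  rewrite !permM groupM ?groupV // gg' permK => /(_ isT erefl).
  exact: (canRL (permKV g')).
exists (fun e => w e e1) => [|g e Gg].
  by case: (wP e0) => Gw w0; rewrite stab.
have [[Gw we] [Gw' we']] := (wP e, wP (g e)).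
by rewrite -permM; apply: same; rewrite ?groupM // permM we.
Qed.

Lemma coset_expg (T : {group {perm E}}) t x k n : x \in 'N(T) -> t \in T ->
  exists2 t', t' \in T & (t * x ^+ k) ^+ n = t' * x ^+ (k * n).
Proof.
move=> nTx Tt; elim: n => [|n [t' Tt' IH]].
  by exists 1; rewrite ?muln0 ?mulg1.
exists (t * t' ^ (x ^- k)).
  by rewrite groupM // memJ_norm // groupV groupX.
by rewrite expgS IH mulnS expgD conjgE invgK !mulgA mulgKV.
Qed.

(* [T] plays the translations and [x ^+ n] a half-turn.  The stabiliser of [e0]
   lies in [T], so it fixes every image of [e0] under [T] and [T * x ^+ n], which
   makes these elements act as equivariant maps. *)
Lemma rotation_classes (T : {group {perm E}}) x z n (e0 : E) :
    abelian T -> x \in 'N(T) -> z \in T * <[x]> -> x ^+ n.*2 = 1 ->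
    (forall t, t \in T -> t ^ (x ^+ n) = t^-1) ->
    (forall t k, t \in T -> 0 < k < n.*2 -> fixfree (t * x ^+ k)) -> 0 < n ->
    (forall e, e \in orbit 'P <<[set x; z]>> e0) ->
  forall e, exists2 k, k < n & exists2 h : E -> E, h ((x ^+ k) e0) = e
    & forall e', h (x e') = x (h e') /\ h (z e') = z (h e').
Proof.
move=> abT nTx Tz x2n invT free n0 tr e.
pose G := (T <*> <[x]>)%G.
have GE : G = T * <[x]> :> {set _} by rewrite /= norm_joinEr ?cycle_subG.
have Gx : x \in G by rewrite mem_gen // inE cycle_id orbT.
have Gz : z \in G by rewrite GE.
have sub : <<[set x; z]>> \subset G.
  by rewrite gen_subG; apply/subsetP => g /set2P[] ->.
have trG e' : e' \in orbit 'P G e0.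
  by have /orbitP[g gP <-] := tr e'; apply: mem_orbit; apply: (subsetP sub).
have decomp g : g \in G -> exists t k, [/\ t \in T, k < n.*2 & g = t * x ^+ k].
  rewrite GE => /mulsgP[t _ Tt /cycleP[k ->] ->]; exists t, (k %% n.*2).
  by rewrite expg_mod ?ltn_mod ?double_gt0.
have stabT g : g \in G -> g e0 = e0 -> g \in T.
  move=> /decomp[t [[|k] [Tt kn ->]]] fixg; first by rewrite mulg1.
  by have /eqP[] := free t k.+1 Tt kn e0.
have commT s t : s \in T -> t \in T -> s * t = t * s.
  by move=> Ts Tt; apply: (centsP abT).
have aut k t1 : t1 \in G -> (forall g, g \in T -> g e0 = e0 -> g (t1 e0) = t1 e0) ->
    e = (x ^+ k) (t1 e0) -> exists2 h : E -> E, h ((x ^+ k) e0) = e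
    & forall e', h (x e') = x (h e') /\ h (z e') = z (h e').
  move=> Gt1 fix1 ->.
  have [|h h0 hP] := equivariant_map trG (e1 := t1 e0).
    by move=> g Gg g0; apply: fix1 => //; apply: stabT.
  exists h; first by rewrite hP ?h0 ?groupX.
  by move=> e'; split; apply: hP.
have /orbitP[g Gg ge] := trG e; move: (decomp g Gg) => [t [k [Tt kn gE]]].
have Gt : t \in G by rewrite mem_gen // inE Tt.
have [ltkn|lenk] := ltnP k n.
  exists k => //; apply: (aut _ t) => // [s Ts s0|].
    by rewrite -permM commT // permM s0.
  by rewrite -ge gE /= /aperm permM.
exists (k - n); first by rewrite ltn_subLR // addnn.
apply: (aut _ (t * x ^+ n)) => [|s Ts s0|]; first by rewrite groupM ?groupX.
  have xs : x ^+ n * s = s^-1 * x ^+ n.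
    have := invT s^-1; rewrite groupV invgK => /(_ Ts) {1}<-.
    by rewrite -conjgC.
  rewrite -permM -mulgA xs mulgA (commT t s^-1) ?groupV // -mulgA [LHS]permM.
  by rewrite (canLR (permK s) (esym s0)).
by rewrite -permM -mulgA -expgD subnKC // -ge gE.
Qed.

(** * Translation lattices and the rotation groups p6 and p4 *)

Section Lattice.
Variables (a c : {perm E}).
Hypothesis ac : commute a c.

Lemma lattice_abelian : abelian (<[a]> <*> <[c]>).
Proof. by rewrite abelianY !cycle_abelian cents_cycle. Qed.

Lemma latticeP t : t \in <[a]> <*> <[c]> -> exists i j, t = a ^+ i * c ^+ j.
Proof.
rewrite cent_joinEr ?cents_cycle // => /mulsgP[_ _ /cycleP[i ->] /cycleP[j ->] ->].
by exists i, j.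
Qed.

Lemma lattice_norm x : a ^ x \in <[a]> <*> <[c]> -> c ^ x \in <[a]> <*> <[c]> ->
  x \in 'N(<[a]> <*> <[c]>).
Proof.
move=> ax cx; rewrite inE conjYg join_subG -!cycleJ !cycle_subG.
by rewrite ax cx.
Qed.

Lemma lattice_inv s : a ^ s = a^-1 -> c ^ s = c^-1 ->
  forall t, t \in <[a]> <*> <[c]> -> t ^ s = t^-1.
Proof.
move=> sa sc _ /latticeP[i [j ->]].
rewrite conjMg !conjXg sa sc !expVgn -invMg; congr (_^-1).
exact: commuteX2.
Qed.
End Lattice.


(* Conjugating [t * x ^+ k] by [s] multiplies the translation part by
   [s^-1 * s ^ x ^- k]. *)
Lemma fixfree_shift t s x k (T : {group {perm E}}) : abelian T -> x \in 'N(T) ->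
  t \in T -> s \in T ->
  fixfree (t * (s^-1 * s ^ x ^- k) * x ^+ k) -> fixfree (t * x ^+ k).
Proof.
move=> abT nTx Tt Ts /(@fixfreeJ _ s^-1).
suff ->: (t * (s^-1 * s ^ x ^- k) * x ^+ k) ^ s^-1 = t * x ^+ k by [].
rewrite [t * _]mulgA (centsP abT t Tt s^-1) ?groupV // !conjgE !invgK.
by rewrite !mulgA mulgV mul1g mulgKV mulgK.
Qed.

(** Powers of [t * x ^+ k] acquire an uncontrolled translation part, so freeness has to be known on
    the whole coset of [x ^+ m]. *)
Lemma rotation_power_free (T : {group {perm E}}) x k n m t : x \in 'N(T) ->
  (forall t, t \in T -> fixfree (t * x ^+ m)) -> x ^+ (k * n) = x ^+ m ->
  t \in T -> fixfree (t * x ^+ k).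
Proof.
move=> nTx free xm Tt; apply: (@fixfreeX _ n).
by have [t' Tt' ->] := coset_expg k n nTx Tt; rewrite xm; apply: free.
Qed.

(** As [x ^+ n] inverts translations, conjugation by [s] multiplies the translation part by
    [s ^- 2]. Only its class modulo squares matters, and the classes are represented by 1, [a], [c]
    and [a * c]. *)
Lemma half_turn_free a c x n : commute a c -> x \in 'N(<[a]> <*> <[c]>) ->
  (forall t, t \in <[a]> <*> <[c]> -> t ^ (x ^+ n) = t^-1) ->
  fixfree (x ^+ n) -> fixfree (a * x ^+ n) -> fixfree (c * x ^+ n) ->
  fixfree (a * c * x ^+ n) ->
  forall t, t \in <[a]> <*> <[c]> -> fixfree (t * x ^+ n).
Proof.
move=> ac nTx inv f1 fa fc fac t /(latticeP ac)[i [j ->]].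
have abT := lattice_abelian ac.
set T := <[a]> <*> <[c]> in nTx inv abT.
have Ta : a \in T by rewrite mem_gen // inE cycle_id.
have Tc : c \in T by rewrite mem_gen // inE cycle_id orbT.
pose s := a ^+ i./2 * c ^+ j./2.
have Ts : s \in T by rewrite groupM ?groupX.
have acX k l : commute (a ^+ k) (c ^+ l) by apply: commuteX2.
apply: (@fixfree_shift _ s _ _ [group of T]) => //.
  by rewrite groupM ?groupX.
have -> : s ^ x ^- n = s^-1.
  by apply: (conjg_inj (x ^+ n)); rewrite conjgKV inv ?groupV ?invgK.
have -> : a ^+ i * c ^+ j * (s^-1 * s^-1) = a ^+ odd i * c ^+ odd j.
  rewrite -invMg -[s * s]/(s ^+ 2) /s (expgMn _ (acX _ _)) -!expgM !muln2.
  apply: (canLR (mulgK _)); rewrite -{1}[i]odd_double_half -{1}[j]odd_double_half.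
  by rewrite !expgD -!mulgA; congr (_ * _); rewrite !mulgA acX.
by case: (odd i); case: (odd j); rewrite ?expg1 ?mulg1 ?mul1g.
Qed.
 
Lemma conjgMX t x k l : (t * x ^+ k) ^ (x ^+ l) = t ^ (x ^+ l) * x ^+ k.
Proof.
rewrite conjMg; congr (_ * _).
by rewrite conjgE (commuteX2 k l (commute_refl x)) mulKg.
Qed.

(** The three relations present p6. The product [a] of the half-turns [x ^+ 3] and [z] is a
    translation, and [b], [c] are its rotations by 60 and 120 degrees; the relation
    [(x * z) ^+ 3 = 1] yields [b = a * c], as for the corresponding plane vectors, and with it
    commutativity. *)
Lemma hexagonal_classes x z (e0 : E) :
    x ^+ 6 = 1 -> z ^+ 2 = 1 -> (x * z) ^+ 3 = 1 ->
    fixfree (x ^+ 2) -> fixfree (x ^+ 3) -> fixfree z -> fixfree (x * z) ->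
    (forall e, e \in orbit 'P <<[set x; z]>> e0) ->
  forall e, exists2 k, k < 3 & exists2 h : E -> E, h ((x ^+ k) e0) = e
    & forall e', h (x e') = x (h e') /\ h (z e') = z (h e').
Proof.
move=> x6 z2 xz3 fx2 fx3 fz fxz tr.
have zV : z^-1 = z by apply: (mulgI z); rewrite mulgV -z2.
have x3V : x ^- 3 = x ^+ 3 by apply: (mulgI (x ^+ 3)); rewrite mulgV -expgD x6.
pose a := x ^+ 3 * z; pose b := a ^ x; pose c := b ^ x.
have cE : c = a ^ (x ^+ 2) by rewrite /c /b -conjgM.
have ax3 : a ^ (x ^+ 3) = a^-1.
  by rewrite /a conjgE -mulgA mulKg invMg zV x3V.
have cx : c ^ x = a^-1 by rewrite cE -conjgM -expgSr.
have cx3 : c ^ (x ^+ 3) = c^-1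
  by rewrite cE -conjgM -expgD [(2 + 3)%N]addnC expgD conjgM ax3 conjVg.
have xa k l : k + l = 6 -> a ^ (x ^+ k) = x ^+ l * a * x ^+ k.
  move=> kl; rewrite conjgE mulgA; congr (_ * _ * _).
  by rewrite -[LHS]mulg1 -x6 -kl expgD mulKg.
have xzE : x * z = x ^+ 4 * a.
  by rewrite /a mulgA -expgD -[4 + 3]/(6 + 1) expgD x6 mul1g.
have cba : c * b^-1 * a = 1.
  have: a ^ (x ^+ 2) * a ^ (x ^+ 4) * a = 1.
    rewrite (xa 2 4) // (xa 4 2) // -xz3 xzE -[RHS]/(_ * (_ * _)).
    by rewrite [x ^+ 4](expgD x 2 2); move: (x ^+ 2) => y; rewrite !mulgA.
  by rewrite -cE -[4]/(3 + 1) expgD conjgM ax3 conjVg -/b.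
have bE : a ^ x = b by []. have cbE : b ^ x = c by [].
have aE : x ^+ 3 * z = a by []; clearbody a b c.
have bac : b = a * c.
  apply: invg_inj; rewrite invMg; apply: (canRL (mulgK a)); apply: (mulgI c).
  by rewrite mulgA cba mulgV.
have bca : b = c * a.
  apply: (mulgI (c * a)^-1); rewrite mulVg invMg -(conj1g x) -cba.
  by rewrite !conjMg conjVg cbE bE cx.
have ac : commute a c by rewrite /commute -bac.
have Ta : a \in <[a]> <*> <[c]> by rewrite mem_gen // inE cycle_id.
have Tc : c \in <[a]> <*> <[c]> by rewrite mem_gen // inE cycle_id orbT.
have nTx : x \in 'N(<[a]> <*> <[c]>).
  by apply: lattice_norm; rewrite ?bE ?cx ?bac ?groupM ?groupV.
have inv := lattice_inv ac ax3 cx3.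
have ax3z : a * x ^+ 3 = z ^ (x ^+ 3) by rewrite conjgE x3V -aE [RHS]mulgA.
have free3 t : t \in <[a]> <*> <[c]> -> fixfree (t * x ^+ 3).
  have fa : fixfree (a * x ^+ 3) by rewrite ax3z; apply: fixfreeJ.
  apply: half_turn_free => //; rewrite -?bac -?bE.
    by rewrite cE -conjgMX; apply: fixfreeJ.
  by rewrite -[x in a ^ x]expg1 -conjgMX; apply: fixfreeJ.
(* Conjugation now changes the translation part by a sublattice of index 3, with representatives 1,
   [c] and [c^-1]. The last two rotations are conjugate to [(x * z)^-1]. *)
have free2 t : t \in <[a]> <*> <[c]> -> fixfree (t * x ^+ 2).
  have fc : fixfree (c * x ^+ 2).
    have -> : c * x ^+ 2 = ((x * z)^-1) ^ (x ^+ 5).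
      rewrite xzE invMg -[x ^- 4](mulKg (x ^+ 4)) mulgV -[1]x6 (expgD x 4 2) mulKg.
      by rewrite conjgMX (expgD x 3 2) conjgM conjVg ax3 invgK cE.
    exact/fixfreeJ/fixfreeV.
  have fcV : fixfree (c^-1 * x ^+ 2).
    by rewrite -cx3 -conjgMX; apply: fixfreeJ.
  move=> /(latticeP ac)[i [j ->]].
  have abT := lattice_abelian ac.
  have shift t' s m : t' \in <[a]> <*> <[c]> -> s \in <[a]> <*> <[c]> ->
      fixfree (t' * (s^-1 * (s^-1) ^ x) ^+ m * x ^+ 2) -> fixfree (t' * x ^+ 2).
    move=> Tt' Ts; rewrite expgMn; last first.
      by apply: (centsP abT); rewrite ?memJ_norm ?groupV.
    rewrite expVgn -conjXg expVgn => free.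
    apply: (@fixfree_shift _ (s ^+ m) _ _ [group of <[a]> <*> <[c]>]) => //.
      by rewrite groupX.
    have -> // : (s ^+ m) ^ x ^- 2 = (s ^- m) ^ x.
    apply: (conjg_inj (x ^+ 2)); rewrite conjgKV -conjgM -expgS.
    by rewrite inv ?invgK // groupV groupX.
  have cX k : c ^+ k \in <[a]> <*> <[c]> by rewrite groupX.
  (* Each use of [c^-1] trades a factor [a] for a factor [c]. *)
  apply: (shift _ c^-1 i) => //; rewrite ?groupM ?groupX ?groupV //.
  rewrite invgK cx expgMn; last exact: commuteV.
  have -> : a ^+ i * c ^+ j * (c ^+ i * a^-1 ^+ i) = c ^+ (j + i).
    rewrite -mulgA (mulgA (c ^+ j)) -expgD expVgn.
    by rewrite (commuteV (commute_sym (commuteX2 i (j + i) ac))) mulKVg.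
  (* Hence the exponent of [c] matters only modulo 3; below, the remainder 2 is replaced by -1. *)
  have sE : (a * c ^+ 2)^-1 * (a * c ^+ 2)^-1 ^ x = c ^- 3.
    rewrite conjVg -invMg conjMg conjXg bE cx bca.
    by congr (_^-1); rewrite -!mulgA mulKVg mulKg.
  have Ts : a * c ^+ 2 \in <[a]> <*> <[c]> by rewrite groupM ?groupX.
  apply: (shift _ (a * c ^+ 2) ((j + i) %/ 3)) => //; rewrite sE.
  rewrite expVgn -expgM [(3 * _)%N]mulnC {1}(divn_eq (j + i) 3) addnC expgD mulgK.
  have: (j + i) %% 3 < 3 by rewrite ltn_mod.
  case: (_ %% 3) => [|[|[|]]] // _; rewrite ?mul1g //.
  apply: (shift _ (a * c ^+ 2) 1%N) => //; rewrite sE expg1.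
  by rewrite (expgS c 2) invMg mulKVg.
apply: (rotation_classes (T := [group of <[a]> <*> <[c]>]) (n := 3)) => //=.
- exact: lattice_abelian.
- rewrite -(mulKg (x ^+ 3) z) aE x3V conjgCV x3V ax3.
  by rewrite mem_mulg ?groupV ?mem_cycle.
- move=> t [|[|[|[|[|[|k]]]]]] // Tt _.
  + by apply: (rotation_power_free (n := 3) (m := 3) nTx).
  + exact: free2.
  + exact: free3.
  + apply: (rotation_power_free (n := 2) (m := 2) nTx) => //.
    by rewrite -[(4 * 2)%N]/(6 + 2) expgD x6 mul1g.
  + apply: (rotation_power_free (n := 3) (m := 3) nTx) => //.
    by rewrite -[(5 * 3)%N]/(6 * 2 + 3)%N expgD expgM x6 expg1n mul1g.
Qed.

(** The relations present p4, and [b] is the translation [a] turned by 90 degrees. They commute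
    because [(x * z) ^+ 2 = b * a^-1 * x ^+ 2] has trivial square. Of the four classes of half-turns
    one is that of [x ^+ 2], two contain conjugates of [z], and the last contains [(x * z) ^+ 2]. *)
Lemma square_classes x z (e0 : E) :
    x ^+ 4 = 1 -> z ^+ 2 = 1 -> (x * z) ^+ 4 = 1 ->
    fixfree (x ^+ 2) -> fixfree z -> fixfree ((x * z) ^+ 2) ->
    (forall e, e \in orbit 'P <<[set x; z]>> e0) ->
  forall e, exists2 k, k < 2 & exists2 h : E -> E, h ((x ^+ k) e0) = e
    & forall e', h (x e') = x (h e') /\ h (z e') = z (h e').
Proof.
move=> x4 z2 xz4 fx2 fz fxz tr.
have zV : z^-1 = z by apply: (mulgI z); rewrite mulgV -z2.
have x2V : x ^- 2 = x ^+ 2 by apply: (mulgI (x ^+ 2)); rewrite mulgV -expgD x4.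
pose a := x ^+ 2 * z; pose b := a ^ x.
have ax2 : a ^ (x ^+ 2) = a^-1.
  by rewrite /a conjgE -mulgA mulKg invMg zV x2V.
have bx : b ^ x = a^-1 by rewrite -ax2 -conjgM.
have bx2 : b ^ (x ^+ 2) = b^-1 by rewrite conjgM bx conjVg.
have xzE : x * z = x ^+ 3 * a.
  by rewrite /a mulgA -expgD -[3 + 2]/(4 + 1) expgD x4 mul1g.
have bE : a ^ x = b by []. have aE : x ^+ 2 * z = a by []; clearbody a b.
have xa : x ^+ 2 * a = a^-1 * x ^+ 2 by rewrite conjgCV x2V ax2.
have xz2 : (x * z) ^+ 2 = b * a^-1 * x ^+ 2.
  have bx3 : x ^+ 3 * a = b * x ^+ 3.
    have xV : x^-1 = x ^+ 3 by apply: (mulgI x); rewrite mulgV -expgS x4.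
    by rewrite -bE conjgE -[RHS]mulgA -[a * x * _]mulgA -expgS x4 mulg1 xV.
  by rewrite expgS expg1 {1}xzE bx3 xzE -mulgA (mulgA (x ^+ 3)) -expgD
             -[(3 + 3)%N]/(4 + 2) expgD x4 mul1g xa mulgA.
have ab : commute a b.
  have ba2 : x ^+ 2 * (b * a^-1) = b^-1 * a * x ^+ 2.
    by rewrite conjgCV x2V conjMg bx2 conjVg ax2 invgK.
  have : (b * a^-1) * (b^-1 * a) = 1.
    rewrite -xz4 (expgM _ 2 2) xz2 expgS expg1 -[RHS]mulgA (mulgA (x ^+ 2)) ba2.
    by rewrite -[b^-1 * a * _ * _]mulgA -expgD x4 mulg1.
  move=> /(canRL (mulgK _)); rewrite mul1g invMg invgK => ba.
  by rewrite -[a]invgK; apply/commute_sym/commuteV.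
have Ta : a \in <[a]> <*> <[b]> by rewrite mem_gen // inE cycle_id.
have Tb : b \in <[a]> <*> <[b]> by rewrite mem_gen // inE cycle_id orbT.
have nTx : x \in 'N(<[a]> <*> <[b]>).
  by apply: lattice_norm; rewrite ?bE ?bx ?groupV.
have inv := lattice_inv ab ax2 bx2.
have free2 t : t \in <[a]> <*> <[b]> -> fixfree (t * x ^+ 2).
  have fa : fixfree (a * x ^+ 2).
    have -> : a * x ^+ 2 = z ^ (x ^+ 2) by rewrite conjgE x2V -aE [RHS]mulgA.
    exact: fixfreeJ.
  apply: half_turn_free => //.
    by rewrite -bE -[x in a ^ x]expg1 -conjgMX; apply: fixfreeJ.
  apply: (@fixfree_shift _ a _ _ [group of <[a]> <*> <[b]>]) => //.
  - exact: lattice_abelian.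
  - by rewrite groupM.
  rewrite x2V ax2; suff -> : a * b * (a^-1 * a^-1) * x ^+ 2 = (x * z) ^+ 2 by [].
  by rewrite xz2 ab; congr (_ * _); rewrite mulgA mulgK.
apply: (rotation_classes (T := [group of <[a]> <*> <[b]>]) (n := 2)) => //=.
- exact: lattice_abelian.
- rewrite -(mulKg (x ^+ 2) z) aE x2V conjgCV x2V ax2.
  by rewrite mem_mulg ?groupV ?mem_cycle.
- move=> t [|[|[|[|k]]]] // Tt _.
  + by apply: (rotation_power_free (n := 2) (m := 2) nTx).
  + exact: free2.
  + apply: (rotation_power_free (n := 2) (m := 2) nTx) => //.
    by rewrite -[(3 * 2)%N]/(4 + 2) expgD x4 mul1g.
Qed.
End FreeRotations.

(* [x] and [z] are only required to behave as rotations on the subset [E]. *)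
Section LatticeAction.
Variables (D : finType) (E : pred D) (x z : D -> D) (e0 : D).
Hypotheses (E0 : E e0) (Ex : forall e, E e -> E (x e)) (Ez : forall e, E e -> E (z e)).

(** Transitivity on [E], phrased as an induction principle because it will come from connectedness
    of the corners. *)
Definition generated_from : Prop := forall S : pred D, S e0 ->
  (forall e, E e -> S e -> S (x e)) -> (forall e, E e -> S e -> S (z e)) ->
  forall e, E e -> S e.

Definition classes_at_most n : Prop := forall e, E e ->
  exists2 k, k < n & exists2 h : D -> D, h (iter k x e0) = e &
    forall e', E e' -> [/\ E (h e'), h (x e') = x (h e') & h (z e') = z (h e')].

Let sE := {e | E e}.

Lemma restriction_perm (f : D -> D) n : (forall e, E e -> E (f e)) ->
    (forall e, E e -> iter n.+1 f e = e) ->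
  exists p : {perm sE}, forall e, val (p e) = f (val e).
Proof.
move=> Ef fn; pose g (e : sE) : sE := Sub (f (val e)) (Ef _ (valP e)).
have g_inj : injective g.
  move=> e e' /(congr1 val)/= ee'; apply: val_inj.
  by rewrite -(fn _ (valP e)) -(fn _ (valP e')) !iterSr ee'.
by exists (perm g_inj) => e; rewrite permE.
Qed.

Lemma val_permX (p : {perm sE}) f n e :
  (forall e, val (p e) = f (val e)) -> val ((p ^+ n)%g e) = iter n f (val e).
Proof. by move=> pE; rewrite permX; elim: n => //= n <-; rewrite pE. Qed.

Lemma classes_from_perm (p q : {perm sE}) n :
    (forall e, val (p e) = x (val e)) -> (forall e, val (q e) = z (val e)) ->
    generated_from ->
    ((forall e, e \in orbit 'P <<[set p; q]>> (Sub e0 E0 : sE)) ->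
     forall e, exists2 k, k < n & exists2 h : sE -> sE,
       h ((p ^+ k)%g (Sub e0 E0)) = e &
       forall e', h (p e') = p (h e') /\ h (q e') = q (h e')) ->
  classes_at_most n.
Proof.
move=> pE qE gen classes e Ee.
pose G := <<[set p; q]>>%g; pose s0 : sE := Sub e0 E0.
have Gp : p \in G by rewrite mem_gen // set21.
have Gq : q \in G by rewrite mem_gen // set22.
pose P := [pred e | [exists s : sE, (val s == e) && (s \in orbit 'P G s0)]].
have PE : forall e, E e -> P e.
  apply: gen.
  - by apply/existsP; exists s0; rewrite orbit_refl andbT.
  - move=> _ _ /existsP[s /andP[/eqP<- orb]]; apply/existsP; exists (p s).
    by rewrite pE eqxx (orbit_trans (mem_orbit 'P s Gp)).
  - move=> _ _ /existsP[s /andP[/eqP<- orb]]; apply/existsP; exists (q s).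
    by rewrite qE eqxx (orbit_trans (mem_orbit 'P s Gq)).
have [s|k kn [h h0 hP]] := classes _ (Sub e Ee).
  by have /existsP[s' /andP[/eqP/val_inj-> ]] := PE _ (valP s).
(* The value outside [E] is a mere default. *)
pose hD e := if insub e is Some s then val (h s) else e.
have hE (s : sE) : hD (val s) = val (h s) by rewrite /hD valK.
exists k => //; exists hD.
  by rewrite -[e0]/(val s0) -(val_permX _ _ pE) hE h0.
move=> e' Ee'; rewrite -[e']/(val (Sub e' Ee' : sE)); set s := Sub _ _.
have [hp hq] := hP s.
by rewrite -pE -qE !hE hp hq pE qE; split=> //; apply: valP.
Qed.

Lemma hexagonal_action :
    (forall e, E e -> [/\ iter 6 x e = e, z (z e) = e & iter 3 (fun e => x (z e)) e = e]) ->
    (forall e, E e -> [/\ x (x e) != e, x (x (x e)) != e, z e != e & x (z e) != e]) ->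
    generated_from -> classes_at_most 3.
Proof.
move=> relations free gen.
have [p pE] : exists p : {perm sE}, forall e, val (p e) = x (val e).
  by apply: (@restriction_perm x 5) => // e /relations[].
have [q qE] : exists q : {perm sE}, forall e, val (q e) = z (val e).
  by apply: (@restriction_perm z 1) => // e /relations[].
have qpE e : val ((q * p)%g e) = x (z (val e)) by rewrite permM pE qE.
have q2 : (q ^+ 2 = 1)%g.
  apply/permP => e; apply: val_inj; rewrite (val_permX _ _ qE) perm1.
  by have [] := relations _ (valP e).
(* Permutations compose from left to right, so [x (z e)] is given by [q * p], while the group
   relations are stated for its conjugate [p * q]. *)
have pqJ : (p * q = (q * p) ^ q)%g.
  by rewrite conjgE !mulgA mulVg mul1g.
apply: (classes_from_perm pE qE gen); apply: hexagonal_classes => //.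
- apply/permP => e; apply: val_inj; rewrite (val_permX _ _ pE) perm1.
  by have [] := relations _ (valP e).
- rewrite pqJ -conjXg; suff -> : ((q * p) ^+ 3 = 1)%g by rewrite conj1g.
  apply/permP => e; apply: val_inj; rewrite (val_permX (f := fun c => x (z c)) _ _ qpE) perm1.
  by have [] := relations _ (valP e).
- by move=> e; rewrite -val_eqE (val_permX _ _ pE); have [] := free _ (valP e).
- by move=> e; rewrite -val_eqE (val_permX _ _ pE); have [] := free _ (valP e).
- by move=> e; rewrite -val_eqE qE; have [] := free _ (valP e).
- rewrite pqJ; apply: fixfreeJ => e.
  by rewrite -val_eqE qpE; have [] := free _ (valP e).
Qed.

Lemma square_action :
    (forall e, E e -> [/\ iter 4 x e = e, z (z e) = e & iter 4 (fun e => x (z e)) e = e]) ->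
    (forall e, E e -> [/\ x (x e) != e, z e != e & x (z (x (z e))) != e]) ->
    generated_from -> classes_at_most 2.
Proof.
move=> relations free gen.
have [p pE] : exists p : {perm sE}, forall e, val (p e) = x (val e).
  by apply: (@restriction_perm x 3) => // e /relations[].
have [q qE] : exists q : {perm sE}, forall e, val (q e) = z (val e).
  by apply: (@restriction_perm z 1) => // e /relations[].
have qpE e : val ((q * p)%g e) = x (z (val e)) by rewrite permM pE qE.
have q2 : (q ^+ 2 = 1)%g.
  apply/permP => e; apply: val_inj; rewrite (val_permX _ _ qE) perm1.
  by have [] := relations _ (valP e).
have pqJ : (p * q = (q * p) ^ q)%g.
  by rewrite conjgE !mulgA mulVg mul1g.
apply: (classes_from_perm pE qE gen); apply: square_classes => //.
- apply/permP => e; apply: val_inj; rewrite (val_permX _ _ pE) perm1.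
  by have [] := relations _ (valP e).
- rewrite pqJ -conjXg; suff -> : ((q * p) ^+ 4 = 1)%g by rewrite conj1g.
  apply/permP => e; apply: val_inj; rewrite (val_permX (f := fun c => x (z c)) _ _ qpE) perm1.
  by have [] := relations _ (valP e).
- by move=> e; rewrite -val_eqE (val_permX _ _ pE); have [] := free _ (valP e).
- by move=> e; rewrite -val_eqE qE; have [] := free _ (valP e).
- rewrite pqJ -conjXg; apply: fixfreeJ => e.
  by rewrite -val_eqE (val_permX (f := fun c => x (z c)) _ _ qpE); have [] := free _ (valP e).
Qed.
End LatticeAction.

(** * Maps as sets of corners *)

(* A corner is a face together with one of its vertices, its site; [fnext] moves
   the corner along the face, [vnext] around the vertex. *)
Record corner_map := CornerMap {
  corner : finType;
  place : eqType;
  fnext : corner -> corner;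
  fprev : corner -> corner;
  vnext : corner -> corner;
  vprev : corner -> corner;
  site : corner -> place;
  fsize : corner -> nat;
  fnextK : cancel fnext fprev;
  fprevK : cancel fprev fnext;
  vnextK : cancel vnext vprev;
  vprevK : cancel vprev vnext;
  edge_flip : forall c, fnext (vprev (fnext c)) = vnext c;
  site_vnext : forall c, site (vnext c) = site c;
  site_iter_fnext : forall c i, 0 < i < fsize c -> site (iter i fnext c) != site c;
  iter_fsize : forall c, iter (fsize c) fnext c = c;
  fsize_fnext : forall c, fsize (fnext c) = fsize c;
  corner_connected : forall (S : corner -> Prop) c, S c ->
    (forall c, S c -> S (fnext c)) -> (forall c, S c -> S (vnext c)) -> forall c, S c
}.

Section CornerMap.
Variable M : corner_map.
Local Notation D := (corner M).
Local Notation F := (@fnext M).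
Local Notation F' := (@fprev M).
Local Notation R := (@vnext M).
Local Notation R' := (@vprev M).
Implicit Types c e : D.

Definition symmetry (h : D -> D) : Prop :=
  (forall c, h (F c) = F (h c)) /\ (forall c, h (R c) = R (h c)).

Definition site_classes_at_most n : Prop := exists2 L : seq D, size L <= n &
  forall c, exists2 e, e \in L & exists2 h, symmetry h & site (h e) = site c.

(* The corners [u k e], for [k < K], form the piece of the map attached to
   [e \in E]; [Fu] and [Ru] say how the pieces are glued.  A map commuting with
   [x] and [z] on [E] then extends to a symmetry. *)
Section Words.
Variables (E : pred D) (x z : D -> D) (K : nat) (u : nat -> D -> D) (e0 : D).

(** The gluing of pieces is recorded by words independent of [e], since these are respected by any
    map commuting with [x] and [z]. The head acts last: [[:: true; false]] is [x (z e)]. *)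
Definition word (w : seq bool) e := foldr (fun b => if b then x else z) e w.

Hypotheses (E0 : E e0) (Ex : forall e, E e -> E (x e)) (Ez : forall e, E e -> E (z e)).
Hypothesis u0 : forall e, u 0 e = e.
Hypothesis K0 : 0 < K.
Hypothesis u_inj : forall j k e e', j < K -> k < K -> E e -> E e' ->
  u j e = u k e' -> j = k /\ e = e'.
Hypothesis Fu : forall k, k < K -> exists2 j, j < K &
  exists w, forall e, E e -> F (u k e) = u j (word w e).
Hypothesis Ru : forall k, k < K -> exists2 j, j < K &
  exists w, forall e, E e -> R (u k e) = u j (word w e).

Lemma word_ind (S : D -> Prop) w e : (forall e, E e -> S e -> S (x e)) ->
  (forall e, E e -> S e -> S (z e)) -> E e -> S e -> E (word w e) /\ S (word w e).
Proof.
move=> Sx Sz Ee Se; elim: w => [|b w [Ew Sw]] //=.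
by case: b; split; auto.
Qed.

Lemma word_cover (S : D -> Prop) : S e0 ->
  (forall e, E e -> S e -> S (x e)) -> (forall e, E e -> S e -> S (z e)) ->
  forall c, exists2 k, k < K & exists e, [/\ E e, S e & c = u k e].
Proof.
move=> S0 Sx Sz; apply: (@corner_connected M _ e0).
- by exists 0 => //; exists e0; rewrite u0.
- move=> _ [k kK [e [Ee Se ->]]]; have [j jK [w ->]] := Fu kK; last by [].
  by exists j => //; exists (word w e); have [] := word_ind w Sx Sz Ee Se.
- move=> _ [k kK [e [Ee Se ->]]]; have [j jK [w ->]] := Ru kK; last by [].
  by exists j => //; exists (word w e); have [] := word_ind w Sx Sz Ee Se.
Qed.

Lemma word_split c : exists k e, [/\ k < K, E e & c = u k e].
Proof.
have [//|//|k kK [e [Ee _ ce]]] := word_cover (S := fun _ => True) I _ _ c.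
by exists k, e.
Qed.

Lemma word_generated : generated_from E x z e0.
Proof.
move=> S S0 Sx Sz e Ee.
have [k kK [e' [Ee' Se' ee']]] := word_cover (S := S) S0 Sx Sz e.
by have [_ ->] : 0 = k /\ e = e' by apply: u_inj; rewrite ?u0.
Qed.

Lemma symmetry_extends (h : D -> D) :
    (forall e, E e -> [/\ E (h e), h (x e) = x (h e) & h (z e) = z (h e)]) ->
  exists2 h' : D -> D, symmetry h' & forall k e, k < K -> E e -> h' (u k e) = u k (h e).
Proof.
move=> hP.
have /fin_all_exists[h' h'P] c : exists c', forall k e, k < K -> E e ->
    c = u k e -> c' = u k (h e).
  have [k [e [kK Ee ->]]] := word_split c.
  by exists (u k (h e)) => j e' jK Ee' /u_inj[] // -> ->.
have h'u k e : k < K -> E e -> h' (u k e) = u k (h e) by move=> kK Ee; apply: h'P.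
have Ew w e : E e -> E (word w e).
  by move=> Ee; case: (@word_ind (fun _ => True) w e).
have hw w e : E e -> h (word w e) = word w (h e).
  move=> Ee; elim: w => //= b w <-; have [_ hx hz] := hP _ (Ew w e Ee).
  by case: b.
exists h' => //.
split=> c; have [k [e [kK Ee ->]]] := word_split c;
  have [Eh _ _] := hP e Ee.
- by have [j jK [w FE]] := Fu kK; rewrite FE // !h'u ?Ew // hw // -FE.
- by have [j jK [w RE]] := Ru kK; rewrite RE // !h'u ?Ew // hw // -RE.
Qed.

(** A piece may meet several sites; [v i], for [i < l], picks a corner at each of them in a way
    compatible with symmetries. *)
Lemma word_site_classes n l (v : nat -> D -> D) : classes_at_most E x z e0 n ->
    (forall k, k < K -> exists2 i, i < l & forall e, site (u k e) = site (v i e)) ->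
    (forall h, symmetry h -> forall i e, h (v i e) = v i (h e)) ->
  site_classes_at_most (n * l).
Proof.
move=> classes v_site v_sym.
exists [seq v i (iter m x e0) | m <- iota 0 n, i <- iota 0 l].
  by rewrite size_allpairs !size_iota.
move=> c; have [k [e [kK Ee ->]]] := word_split c.
have [i il site_i] := v_site k kK.
have [m mn [h he hP]] := classes e Ee.
exists (v i (iter m x e0)).
  by apply/allpairsP; exists (m, i); rewrite !mem_iota.
have [h' sym_h' h'P] := symmetry_extends hP.
exists h' => //; rewrite v_sym // site_i; congr (site (v _ _)).
have Em : E (iter m x e0) by elim: (m) => //= p; apply: Ex.
by rewrite -[in LHS](u0 (iter m x e0)) h'P // u0.
Qed.
End Words.

Lemma word_cat x z (w1 w2 : seq bool) e : word x z (w1 ++ w2) e = word x z w1 (word x z w2 e).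
Proof. by rewrite /word foldr_cat. Qed.

Lemma word_nseq x z w n e : word x z (flatten (nseq n w)) e = iter n (word x z w) e.
Proof. by elim: n => //= n IHn; rewrite word_cat IHn. Qed.

Lemma spin_injective : injective R. Proof. exact: can_inj (@vnextK M). Qed.

Lemma iter_spin_inj k : injective (iter k R).
Proof. by elim: k => // k IHk c c' /spin_injective/IHk. Qed.

Lemma site_iter_vnext k c : site (iter k R c) = site c.
Proof. by elim: k => //= k <-; rewrite site_vnext. Qed.

(** The case of one marked corner at each vertex: a piece consists of the [K] corners at a site, and
    only the gluing along [fnext] remains to be described. *)
Lemma spin_site_classes (E : pred D) (x z : D -> D) K e0 n : E e0 ->
    (forall e, E e -> E (x e)) -> (forall e, E e -> E (z e)) ->
    0 < K -> (forall c, iter K R c = c) ->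
    (forall e i, E e -> 0 < i < K -> ~~ E (iter i R e)) ->
    (forall k, k < K -> exists2 j, j < K &
       exists w, forall e, E e -> F (iter k R e) = iter j R (word x z w e)) ->
    (generated_from E x z e0 -> classes_at_most E x z e0 n) ->
  site_classes_at_most n.
Proof.
move=> E0 Ex Ez K0 RK noE Fu classes.
have inj_le j k e e' : j <= k -> k < K -> E e -> E e' ->
    iter j R e = iter k R e' -> j = k /\ e = e'.
  move=> jk kK Ee Ee'; rewrite -(subnKC jk) iterD => /iter_spin_inj.
  case: (posnP (k - j)) => [-> // -> | kj eE]; first by rewrite addn0.
  have := noE e' (k - j) Ee'; rewrite kj (leq_ltn_trans (leq_subr _ _) kK) => /(_ isT).
  by rewrite -eE Ee.
have u_inj j k e e' : j < K -> k < K -> E e -> E e' ->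
    iter j R e = iter k R e' -> j = k /\ e = e'.
  move=> jK kK Ee Ee' eqR; have [jk|/ltnW kj] := leqP j k; first exact: inj_le.
  by have [-> ->] := inj_le k j e' e kj jK Ee' Ee (esym eqR).
have Ru k : k < K -> exists2 j, j < K &
    exists w, forall e, E e -> R (iter k R e) = iter j R (word x z w e).
  rewrite leq_eqVlt => /predU1P[kK|kK]; last by exists k.+1 => //; exists [::].
  by exists 0 => //; exists [::] => e _; rewrite -iterS kK RK.
rewrite -[n]muln1.
apply: (@word_site_classes E x z K (fun k => iter k R) e0 E0 Ex Ez _ K0
  u_inj Fu Ru _ _ (fun _ => id)) => //.
  by apply: classes; apply: (@word_generated E x z K (fun k => iter k R)).
by move=> k kK; exists 0 => // e; apply: site_iter_vnext.
Qed.

(** Both sides are the corner at the far end of the edge leaving [c], in the face across that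
    edge. *)
Lemma fprev_vnext c : F' (R c) = R' (F c).
Proof. by rewrite -edge_flip fnextK. Qed.

Lemma vnext_fprev c : R (F' c) = F (R' c).
Proof. by rewrite -edge_flip fprevK. Qed.

Lemma site_vprev c : site (R' c) = site c.
Proof. by rewrite -{2}(vprevK c) site_vnext. Qed.

Lemma fsize_fprev c : fsize (F' c) = fsize c.
Proof. by rewrite -{2}(fprevK c) fsize_fnext. Qed.

Lemma iter_fnextK n c : iter n F' (iter n F c) = c.
Proof. by elim: n c => // n IHn c; rewrite iterSr iterS fnextK IHn. Qed.

Lemma iter_fprevK n c : iter n F (iter n F' c) = c.
Proof. by elim: n c => // n IHn c; rewrite iterSr iterS fprevK IHn. Qed.

Lemma fsize_iter_fprev n c : fsize (iter n F' c) = fsize c.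
Proof. by elim: n => //= n <-; rewrite fsize_fprev. Qed.

Lemma iter_fsize_fprev c : iter (fsize c) F' c = c.
Proof. by rewrite -{2}(iter_fsize c) iter_fnextK. Qed.

Lemma site_iter_fprev c i : 0 < i < fsize c -> site (iter i F' c) != site c.
Proof.
move=> ic; rewrite -{2}(iter_fprevK i c) eq_sym.
by apply: site_iter_fnext; rewrite fsize_iter_fprev.
Qed.

Lemma fprevE c n : fsize c = n.+1 -> F' c = iter n F c.
Proof. by move=> cn; rewrite -{1}(iter_fsize c) cn iterS fnextK. Qed.

Lemma spin_neq c c' : site c != site c' -> c != c'.
Proof. by apply: contraNneq => ->. Qed.

(** * Vertex types on corners, and the types [p,2q,2q] *)

Definition reads ps e := [seq fsize (iter i R e) | i <- iota 0 (size ps)] = ps /\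
  iter (size ps) R e = e.

(* The listing of the polygons may go around the site in either direction, hence
   the reversal. *)
Definition has_type ps : Prop := forall c, exists i e,
  [/\ i < size ps, c = iter i R e & reads ps e \/ reads (rev ps) e].

Lemma type_iter_vnext ps c : has_type ps -> iter (size ps) R c = c.
Proof.
move=> /(_ c)[i [e [_ -> ]]]; rewrite -iterD addnC iterD.
by case=> [] [_]; rewrite ?size_rev => ->.
Qed.

(* [z] is the half-turn about the midpoint of the edge between the two
   [q.*2]-gons at a vertex, [x] a rotation about one of these polygons. *)
Section Truncated.
Variables p q : nat.
Hypothesis typeM : has_type [:: p; q.*2; q.*2].
Hypothesis pq : p != q.*2.
Let E := [pred c : D | fsize c == p].
Let z c := R (F (R c)).
Let x c := F (z c).

Lemma truncated_cubic c : R (R (R c)) = c.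
Proof. exact: (type_iter_vnext c typeM). Qed.

Lemma truncated_sizes c : [\/
  [/\ fsize c = p, fsize (R c) = q.*2 & fsize (R (R c)) = q.*2],
  [/\ fsize c = q.*2, fsize (R c) = q.*2 & fsize (R (R c)) = p] |
  [/\ fsize c = q.*2, fsize (R c) = p & fsize (R (R c)) = q.*2]].
Proof.
have [i [e [i3 ->]]] := typeM c.
by case: i i3 => [|[|[|]]] //= _ [] [] [e0 e1 e2] /= _;
  rewrite ?truncated_cubic ?e0 ?e1 ?e2; do [exact: Or31 | exact: Or32 | exact: Or33].
Qed.

Lemma truncated_next c : E c -> fsize (R c) = q.*2 /\ fsize (R (R c)) = q.*2.
Proof.
by move=> /eqP cp; case: (truncated_sizes c) => [] [] // cq; move: pq; rewrite -cp cq eqxx.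
Qed.

(** The two [q.*2]-gons at [e] share the edge leaving [R e], so they also meet at its other end, and
    the polygon remaining there is a [p]-gon. *)
Lemma truncated_z e : E e -> E (z e).
Proof.
move=> /truncated_next[e1 e2]; rewrite inE /z.
have d2 : fsize (R (R (F (R e)))) = q.*2.
  have -> : R (R (F (R e))) = R' (F (R e)) by rewrite -[in RHS](truncated_cubic (F _)) vnextK.
  by rewrite -fprev_vnext fsize_fprev.
case: (truncated_sizes (F (R e))) => [] [d1 d d']; rewrite ?d ?eqxx // eq_sym.
  by rewrite -d1 fsize_fnext e1.
by rewrite -d' d2.
Qed.

Lemma cubic_vprev c : R' c = R (R c).
Proof. by rewrite -[in LHS](truncated_cubic c) vnextK. Qed.

Lemma truncated_zz c : z (z c) = c.
Proof. by rewrite /z -(cubic_vprev (F _)) edge_flip truncated_cubic. Qed.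

Lemma truncated_xz c : x (z c) = F c.
Proof. by rewrite /x truncated_zz. Qed.

(** Seen from the face of [R (R c)], [x] is two steps backwards; on a [q.*2]-gon it therefore has
    order [q]. *)
Lemma truncated_iter_x k c : iter k x c = R (iter k.*2 F' (R (R c))).
Proof.
have FR c' : F (R c') = R (F' (R (R c'))).
  by rewrite vnext_fprev cubic_vprev !truncated_cubic.
elim: k => [|k IHk]; first by rewrite truncated_cubic.
by rewrite iterS IHk doubleS /= /x /z !FR !truncated_cubic.
Qed.

Hypothesis q3 : 2 < q.

Lemma truncated_x_order e : E e -> iter q x e = e.
Proof.
move=> /truncated_next[_ e2].
by rewrite truncated_iter_x -e2 iter_fsize_fprev truncated_cubic.
Qed.

Lemma truncated_x_free e k : E e -> 0 < k < q -> iter k x e != e.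
Proof.
move=> /truncated_next[_ e2] /andP[k0 kq]; apply: spin_neq.
rewrite truncated_iter_x site_vnext -{2}(truncated_cubic e) site_vnext.
by apply: site_iter_fprev; rewrite e2 double_gt0 k0 ltn_double.
Qed.

Lemma truncated_z_free e : E e -> z e != e.
Proof.
move=> /truncated_next[e1 _]; apply: spin_neq.
rewrite /z site_vnext -(site_vnext e); apply: (site_iter_fnext (i := 1)).
by rewrite e1 -[1]/(1.*2.-1) -ltnS; case: (q) q3.
Qed.

Lemma truncated_x e : E e -> E (x e).
Proof. by move=> /truncated_z; rewrite /x !inE fsize_fnext. Qed.

Lemma truncated_site_classes n e0 : E e0 -> 0 < p ->
  (generated_from E x z e0 -> classes_at_most E x z e0 n) -> site_classes_at_most n.
Proof.
move=> E0 p0; apply: (spin_site_classes (K := 3)) => //.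
- exact: truncated_x.
- exact: truncated_z.
- exact: truncated_cubic.
- move=> e [|[|[|i]]] // /truncated_next[e1 e2] _; rewrite inE /= ?e1 ?e2 eq_sym.
    exact: pq.
  exact: pq.
- have FE e : F e = word x z [:: true; false] e by rewrite /= truncated_xz.
  case=> [|[|[|]]] // _.
  + by exists 0 => //; exists [:: true; false] => e _.
  + by exists 2 => //; exists [:: false] => e _; rewrite /= /z !truncated_cubic.
  (* Here [F (R (R e)) = R (F' e)]. Words contain no inverses, so the step back along the [p]-gon is
     written as [p.-1] steps forward. *)
  + exists 1 => //; exists (flatten (nseq p.-1 [:: true; false])) => e /eqP ep.
    rewrite word_nseq -(eq_iter FE) -(@fprevE e p.-1) ?prednK //=.
    by rewrite vnext_fprev cubic_vprev.
Qed.

Lemma truncated_corner (c : D) : exists e, E e.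
Proof.
case: (truncated_sizes c) => [] [c1 c2 c3].
- by exists c; apply/eqP.
- by exists (R (R c)); apply/eqP.
- by exists (R c); apply/eqP.
Qed.
End Truncated.

Lemma site_classes_3_12_12 (c : D) : has_type [:: 3; 12; 12] -> site_classes_at_most 3.
Proof.
move=> typeM; have [e0 E0] := truncated_corner (q := 6) typeM c.
apply: (truncated_site_classes (q := 6) typeM _ E0) => // gen.
have Fxz := eq_iter (truncated_xz (q := 6) typeM).
apply: (hexagonal_action E0) gen => [||e Ee|e Ee].
- exact: (truncated_x (q := 6) typeM).
- exact: (truncated_z (q := 6) typeM).
- split; first exact: (truncated_x_order (q := 6) typeM).
    exact: (truncated_zz (q := 6) typeM).
  by rewrite Fxz -{2}(iter_fsize e) (eqP Ee).
- have x_free k := truncated_x_free (q := 6) (k := k) typeM isT Ee.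
  split; [exact: (x_free 2) | exact: (x_free 3) | |].
    exact: (truncated_z_free (q := 6) typeM).
  rewrite (truncated_xz (q := 6) typeM); apply: spin_neq.
  by apply: (site_iter_fnext (i := 1)); rewrite (eqP Ee).
Qed.

Lemma site_classes_4_8_8 (c : D) : has_type [:: 4; 8; 8] -> site_classes_at_most 2.
Proof.
move=> typeM; have [e0 E0] := truncated_corner (q := 4) typeM c.
apply: (truncated_site_classes (q := 4) typeM _ E0) => // gen.
have Fxz := truncated_xz (q := 4) typeM.
apply: (square_action E0) gen => [||e Ee|e Ee].
- exact: (truncated_x (q := 4) typeM).
- exact: (truncated_z (q := 4) typeM).
- split; first exact: (truncated_x_order (q := 4) typeM).
    exact: (truncated_zz (q := 4) typeM).
  by rewrite (eq_iter Fxz) -{2}(iter_fsize e) (eqP Ee).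
- split.
    exact: (truncated_x_free (q := 4) (k := 2) typeM isT Ee).
    exact: (truncated_z_free (q := 4) typeM).
  rewrite !Fxz; apply: spin_neq.
  by apply: (site_iter_fnext (i := 2)); rewrite (eqP Ee).
Qed.
End CornerMap.

(** * The types [3,4,6,4] and [4,6,12] *)

Section UniformTypes.
Variable M : corner_map.
Local Notation D := (corner M).
Local Notation F := (@fnext M).
Local Notation F' := (@fprev M).
Local Notation R := (@vnext M).
Local Notation R' := (@vprev M).
Implicit Types c e : D.

Lemma fsize_vprev_fnext c : fsize (R' (F c)) = fsize (R c).
Proof. by rewrite -fprev_vnext fsize_fprev. Qed.

(* [z] is the half-turn of a square. *)
Section Rhombic.
Hypothesis typeM : has_type M [:: 3; 4; 6; 4].
Let E := [pred c : D | fsize c == 6].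
Let z c := R' (F (F (R c))).

Lemma rhombic_cycle c : R (R (R (R c))) = c.
Proof. exact: (type_iter_vnext c typeM). Qed.

Lemma rhombic_vprev c : R' c = R (R (R c)).
Proof. by rewrite -[in LHS](rhombic_cycle c) vnextK. Qed.

Lemma rhombic_sizes c : exists i, 
  [/\ i < 4, fsize c = nth 0 [:: 6; 4; 3; 4] i, fsize (R c) = nth 0 [:: 4; 3; 4; 6] i,
   fsize (R (R c)) = nth 0 [:: 3; 4; 6; 4] i &
   fsize (R (R (R c))) = nth 0 [:: 4; 6; 4; 3] i].
Proof.
have [i [e [i3 ->]]] := typeM c.
by case: i i3 => [|[|[|[|]]]] //= _ [] [] [e0 e1 e2 e3] /= _;
  rewrite ?rhombic_cycle ?e0 ?e1 ?e2 ?e3;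
  do [by exists 0 | by exists 1 | by exists 2 | by exists 3].
Qed.
 
Lemma rhombic_next e : E e ->
  [/\ fsize (R e) = 4, fsize (R (R e)) = 3 & fsize (R (R (R e))) = 4].
Proof.
move=> /eqP e6; have [i [i3 e0 e1 e2 e3]] := rhombic_sizes e.
by case: i i3 e0 e1 e2 e3 => [|[|[|[|]]]]; rewrite // e6.
Qed.

(** A square is bordered alternately by hexagons and triangles, so its half-turn takes a hexagon
    side to a hexagon side. *)
Lemma rhombic_z e : E e -> E (z e).
Proof.
move=> /rhombic_next[e1 e2 _]; rewrite inE /z fsize_vprev_fnext.
have := fsize_vprev_fnext (R e); rewrite e2 rhombic_vprev.
have [i [i3 _ c1 _ c3]] := rhombic_sizes (F (R e)).
by case: i i3 c1 c3 => [|[|[|[|]]]] // _ -> ->.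
Qed.

Lemma rhombic_zz e : E e -> z (z e) = e.
Proof.
move=> /rhombic_next[e1 _ _]; rewrite /z vprevK.
by have := iter_fsize (R e); rewrite e1 /= => ->; rewrite vnextK.
Qed.

(** Up to two turns around the vertex, the composite is one step backwards along the face of
    [R (R c)], a triangle when [E c]; hence its order 3. *)
Lemma rhombic_iter_xz k c : iter k (fun c => F (z c)) c = R' (R' (iter k F' (R (R c)))).
Proof.
have xz c' : F (z c') = R' (R' (F' (R (R c')))).
  by rewrite /z edge_flip fprev_vnext 3!rhombic_vprev !rhombic_cycle.
by elim: k => [|k IHk]; rewrite ?vnextK //= IHk xz !vprevK.
Qed.

Lemma site_classes_3_4_6_4 (c : D) : site_classes_at_most M 3.
Proof.
have [e0 E0] : exists e, E e.
  have [i [i4 c0 c1 c2 c3]] := rhombic_sizes c.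
  case: i i4 c0 c1 c2 c3 => [|[|[|[|]]]] // _ c0 c1 c2 c3.
  - by exists c; apply/eqP.
  - by exists (R (R (R c))); apply/eqP.
  - by exists (R (R c)); apply/eqP.
  - by exists (R c); apply/eqP.
have Ex e : E e -> E (F e) by rewrite !inE fsize_fnext.
have xz := rhombic_iter_xz.
apply: (spin_site_classes (K := 4) E0 Ex rhombic_z) => // [|e [|[|[|[|i]]]]||gen] //.
- exact: rhombic_cycle.
- by case/rhombic_next => e1 _ _; rewrite inE /= e1.
- by case/rhombic_next => _ e2 _; rewrite inE /= e2.
- by case/rhombic_next => _ _ e3; rewrite inE /= e3.
- case=> [|[|[|[|]]]] // _.
  + by exists 0 => //; exists [:: true].
  + exists 3 => //; exists [:: true; false] => e _ /=.
    by rewrite /z edge_flip rhombic_cycle.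
  (* One step forward along the triangle is two steps backwards. *)
  + exists 2 => //; exists [:: true; false; true; false] => e /rhombic_next[_ e2 _].
    rewrite -[word _ _ _ _]/(iter 2 (fun c => F (z c)) e) xz /= !vprevK.
    by rewrite -[in LHS](iter_fsize_fprev (R (R e))) e2 /= fprevK.
  + exists 1 => //; exists (nseq 5 true) => e /eqP e6.
    by rewrite [iter 3 _ _]/= -rhombic_vprev -vnext_fprev (fprevE e6).
- apply: (hexagonal_action E0 Ex rhombic_z) gen => e Ee; have [e1 e2 _] := rhombic_next Ee.
    split; rewrite ?rhombic_zz ?xz //; first by rewrite -(eqP Ee) iter_fsize.
    by rewrite -e2 iter_fsize_fprev !vnextK.
  split; apply: spin_neq.
  + by apply: (site_iter_fnext (i := 2)); rewrite (eqP Ee).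
  + by apply: (site_iter_fnext (i := 3)); rewrite (eqP Ee).
  + rewrite site_vprev -(site_vnext e).
    by apply: (site_iter_fnext (i := 2)); rewrite e1.
  + rewrite -[F _]/(iter 1 (fun c => F (z c)) e) xz !site_vprev.
    rewrite -(site_iter_vnext 2 e).
    by apply: (site_iter_fprev (i := 1)); rewrite e2.
Qed.
End Rhombic.

(* [E] retains the vertices at which the polygons succeed one another as
   12, 4, 6; the others are their neighbours along the 12-gons.  [z] is the
   half-turn of a square. *)
Section Omnitruncated.
Hypothesis typeM : has_type M [:: 4; 6; 12].
Let E := [pred c : D | (fsize c == 12) && (fsize (R c) == 4)].
Let x c := F (F c).
Let z c := R' (F (F (R c))).

Lemma omni_cycle c : R (R (R c)) = c.
Proof. exact: (type_iter_vnext c typeM). Qed.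

Lemma omni_vprev c : R' c = R (R c).
Proof. by rewrite -[in LHS](omni_cycle c) vnextK. Qed.

Lemma omni_sizes c :
  perm_eq [:: fsize c; fsize (R c); fsize (R' c)] [:: 4; 6; 12].
Proof.
have [i [e [i3 ->]]] := typeM c; rewrite omni_vprev.
by case: i i3 => [|[|[|]]] //= _ [] [] [e0 e1 e2] /= _; rewrite ?omni_cycle ?e0 ?e1 ?e2.
Qed.

(** The two faces along the edge leaving [c] occur at both of its ends, so the third polygons have
    equal size: the three sizes always add up to 22. Adjacent vertices are thus read in opposite
    directions. *)
Lemma fsize_vnext_fnext c : fsize (R (F c)) = fsize (R' c).
Proof.
have sum a b d : perm_eq [:: a; b; d] [:: 4; 6; 12] -> a + b + d = 22.
  by move=> /perm_sumn /=; rewrite addn0 addnA.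
have := sum _ _ _ (omni_sizes (F c)); rewrite -(sum _ _ _ (omni_sizes c)).
by rewrite fsize_fnext fsize_vprev_fnext addnAC => /addnI.
Qed.

Lemma omni_E e : E e -> [/\ fsize e = 12, fsize (R e) = 4 & fsize (R' e) = 6].
Proof.
move=> /andP[/eqP e12 /eqP e4]; have := perm_sumn (omni_sizes e).
by rewrite e12 e4 => /= -[]; rewrite addn0.
Qed.

Lemma omni_x e : E e -> E (x e).
Proof.
move=> /omni_E[e12 e4 e6].
by rewrite /= !fsize_fnext e12 fsize_vnext_fnext fsize_vprev_fnext e4.
Qed.

Lemma omni_z e : E e -> E (z e).
Proof.
move=> /omni_E[e12 e4 _].
by rewrite /= vprevK fsize_vprev_fnext fsize_vnext_fnext vnextK e12 !fsize_fnext e4.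
Qed.

Lemma omni_zz e : E e -> z (z e) = e.
Proof.
move=> /omni_E[_ e4 _]; rewrite /z vprevK.
by have := iter_fsize (R e); rewrite e4 /= => ->; rewrite vnextK.
Qed.

(** When [E c], this is a rotation of the hexagon of [R' c] by two steps, of order 3. *)
Lemma omni_iter_xz k c : iter k (fun c => x (z c)) c = R (iter k.*2 F' (R' c)).
Proof.
have FR c' : F (R c') = R (F' (R' c')).
  by rewrite vnext_fprev 2!omni_vprev omni_cycle.
elim: k => [|k IHk]; first by rewrite vprevK.
by rewrite iterS IHk doubleS /x /z edge_flip !FR !vnextK.
Qed.

Definition omni_piece k c := if k < 3 then iter k R c else iter (k - 3) R (F c).

(** Each ordered pair of distinct sizes occurs for exactly one [k], so the position of a corner in
    its piece can be read off. *)
Lemma omni_piece_sizes k e : k < 6 -> E e ->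
  fsize (omni_piece k e) = nth 0 [:: 12; 4; 6; 12; 6; 4] k /\
  fsize (R (omni_piece k e)) = nth 0 [:: 4; 6; 12; 6; 4; 12] k.
Proof.
move=> k6 /omni_E[e12 e4 e6]; have eF : fsize (R (R (F e))) = 4.
  by rewrite -omni_vprev fsize_vprev_fnext.
case: k k6 => [|[|[|[|[|[|]]]]]] //= _; rewrite /omni_piece /=;
  rewrite ?omni_cycle ?eF ?fsize_vnext_fnext ?fsize_fnext -?omni_vprev //.
Qed.

Lemma omni_piece_inj j k e e' : j < 6 -> k < 6 -> E e -> E e' ->
  omni_piece j e = omni_piece k e' -> j = k /\ e = e'.
Proof.
move=> j6 k6 Ee Ee' eqP; have jk : j = k.
  have [] := omni_piece_sizes j6 Ee; have [] := omni_piece_sizes k6 Ee'.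
  rewrite eqP => -> ->.
  by case: j k j6 k6 {eqP} => [|[|[|[|[|[|]]]]]] // [|[|[|[|[|[|]]]]]].
split=> //; move: eqP; rewrite jk /omni_piece; case: ifP => _ /iter_spin_inj //.
exact: (can_inj (@fnextK M)).
Qed.

Lemma site_classes_4_6_12 (c : D) : site_classes_at_most M 6.
Proof.
have [e0 E0] : exists e, E e.
  have [e e12] : exists e, fsize e = 12.
    have: 12 \in [:: fsize c; fsize (R c); fsize (R' c)].
      by rewrite (perm_mem (omni_sizes c)).
    by rewrite !inE => /or3P[] /eqP ->; [exists c | exists (R c) | exists (R' c)].
  have := omni_sizes e; rewrite e12.
  case: (eqVneq (fsize (R e)) 4) => [e4 _ | eN4 perm_e].
    by exists e; rewrite /= e12 e4.
  exists (F e); rewrite /= fsize_fnext e12 fsize_vnext_fnext /=.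
  have: 4 \in [:: 12; fsize (R e); fsize (R' e)] by rewrite (perm_mem perm_e).
  by rewrite !inE /= eq_sym (negPf eN4) eq_sym.
have u0 e : omni_piece 0 e = e by [].
have Fu k : k < 6 -> exists2 j, j < 6 & exists w,
    forall e, E e -> F (omni_piece k e) = omni_piece j (word x z w e).
  case: k => [|[|[|[|[|[|]]]]]] // _.
  - by exists 3 => //; exists [::].
  - exists 5 => //; exists [:: false] => e _.
    by rewrite /omni_piece /= /z edge_flip omni_cycle.
  (* On a 12-gon, [F'] is eleven steps forward: [x] five times, then the [F] built into piece 4. *)
  - exists 4 => //; exists (nseq 5 true) => e /omni_E[e12 _ _].
    by rewrite /omni_piece /= -omni_vprev -vnext_fprev (fprevE e12).
  - by exists 0 => //; exists [:: true].
  - exists 2 => //; exists [:: false] => e /omni_E[_ e4 _].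
    have FF : F (F (R e)) = F' (F' (R e)).
      by have := iter_fsize (R e); rewrite e4 /= => {2}<-; rewrite !fnextK.
    rewrite /omni_piece /= /z vprevK FF vnext_fprev fprev_vnext.
    by rewrite (omni_vprev (R' _)) vprevK.
  - exists 1 => //; exists [::] => e _.
    by rewrite /omni_piece /= -omni_vprev edge_flip.
have Ru k : k < 6 -> exists2 j, j < 6 & exists w,
    forall e, E e -> R (omni_piece k e) = omni_piece j (word x z w e).
  case: k => [|[|[|[|[|[|]]]]]] // _;
    [exists 1 | exists 2 | exists 0 | exists 4 | exists 5 | exists 3] => //;
    by exists [::] => e _; rewrite /omni_piece /= ?omni_cycle.
apply: (@word_site_classes M E x z 6 omni_piece e0 E0 omni_x omni_z u0 isT
  omni_piece_inj Fu Ru 3 2 (fun i => iter i F)).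
- apply: (hexagonal_action E0 omni_x omni_z) => [e Ee | e Ee |]; last first.
  + exact: (@word_generated M E x z 6 omni_piece e0 E0 omni_x omni_z u0 isT
      omni_piece_inj Fu Ru).
  + have [e12 e4 e6] := omni_E Ee; split; apply: spin_neq.
    * by apply: (site_iter_fnext (i := 4)); rewrite e12.
    * by apply: (site_iter_fnext (i := 6)); rewrite e12.
    * rewrite site_vprev -(site_vnext e).
      by apply: (site_iter_fnext (i := 2)); rewrite e4.
    * rewrite -[x _]/(iter 1 (fun c => x (z c)) e) omni_iter_xz site_vnext -(site_vprev e).
      by apply: (site_iter_fprev (i := 2)); rewrite e6.
  + have [e12 e4 e6] := omni_E Ee; split; [|exact: omni_zz|].
      by have := iter_fsize e; rewrite e12.
    by rewrite omni_iter_xz -[3.*2]/6 -e6 iter_fsize_fprev vprevK.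
- by case=> [|[|[|[|[|[|]]]]]] // _;
    [exists 0 | exists 0 | exists 0 | exists 1 | exists 1 | exists 1] => // e;
    rewrite /omni_piece /= ?site_vnext.
- by move=> h [hF _] i e; elim: i => //= i <-.
Qed.
End Omnitruncated.
End UniformTypes.

(** * The chiral type [3^4,6] *)

Section Mirror.
Variable M : corner_map.

(** On a finite type the inverse of [g] is one of its iterates. *)
Lemma closed_inverse (D : finType) (f g : D -> D) (S : D -> Prop) : cancel g f ->
  (forall c, S c -> S (g c)) -> forall c, S c -> S (f c).
Proof.
move=> gK Sg c Sc; have g_inj := can_inj gK.
have Siter n : S (iter n g c) by elim: n => //= n; apply: Sg.
suff -> : f c = iter (fingraph.order g c).-1 g c by [].
by rewrite -[in LHS](fingraph.iter_order g_inj c) -(prednK (fingraph.order_gt0 g c)) iterS gK.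
Qed.

Lemma mirror_edge_flip (c : corner M) : fprev (vnext (fprev c)) = vprev c.
Proof. by rewrite vnext_fprev fnextK. Qed.

Lemma mirror_connected (S : corner M -> Prop) c : S c ->
  (forall c, S c -> S (fprev c)) -> (forall c, S c -> S (vprev c)) -> forall c, S c.
Proof.
move=> Sc SF SR; apply: (corner_connected Sc).
  exact: (closed_inverse (@fprevK M)).
exact: (closed_inverse (@vprevK M)).
Qed.

Definition mirror := CornerMap (@fprevK M) (@fnextK M) (@vprevK M) (@vnextK M)
  mirror_edge_flip (@site_vprev M) (@site_iter_fprev M) (@iter_fsize_fprev M)
  (@fsize_fprev M) mirror_connected.

Lemma mirror_site_classes n : site_classes_at_most mirror n -> site_classes_at_most M n.
Proof.
move=> [L Ln LP]; exists L => // c; have [e Le [h [hF hR] hc]] := LP c.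
exists e => //; exists h => //; split=> c'.
  by have := hF (fnext c'); rewrite /= fnextK => ->; rewrite fprevK.
by have := hR (vnext c'); rewrite /= vnextK => ->; rewrite vprevK.
Qed.
End Mirror.

(** The cyclic word 3,3,3,3,6 equals its reversal, so it can be stated without a direction; this
    makes it stable under [mirror]. *)
Definition snub_type (M : corner_map) : Prop := forall c : corner M,
  [/\ iter 5 (@vnext M) c = c, exists2 i, i < 5 & fsize (iter i (@vnext M) c) = 6 &
    fsize c = 6 -> forall i, 0 < i < 5 -> fsize (iter i (@vnext M) c) = 3].

(* [z] would be the half-turn about the midpoint of the edge between the first two
   triangles following a hexagon.  The map has one of two chiralities: either [z]
   preserves the hexagon corners, or its analogue in the mirror image does. *)
Section Snub.
Variable M : corner_map.
Local Notation D := (corner M).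
Local Notation F := (@fnext M).
Local Notation F' := (@fprev M).
Local Notation R := (@vnext M).
Local Notation R' := (@vprev M).
Implicit Types c e : D.
Hypothesis typeM : snub_type M.
Let E := [pred c : D | fsize c == 6].
Let z c := R' (R' (F (R c))).

Lemma snub_cycle c : R (R (R (R (R c)))) = c.
Proof. by have [] := typeM c. Qed.

Lemma snub_vprev c : R' c = R (R (R (R c))).
Proof. by rewrite -[in LHS](snub_cycle c) vnextK. Qed.

Lemma snub_vnext c : R c = R' (R' (R' (R' c))).
Proof. by rewrite -[in RHS](snub_cycle c) !vnextK. Qed.

Lemma snub_triangle e i : E e -> 0 < i < 5 -> fsize (iter i R e) = 3.
Proof. by move=> /eqP e6 i5; have [_ _ ->] := typeM e. Qed.

Lemma fprev_triangle c : fsize c = 3 -> F' c = F (F c).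
Proof. exact: fprevE. Qed.

Lemma fprev2_triangle c : fsize c = 3 -> F' (F' c) = F c.
Proof. by move=> c3; rewrite (@fprev_triangle (F' c)) ?fsize_fprev // fprevK. Qed.

Lemma snub_x e : E e -> E (F e).
Proof. by rewrite !inE fsize_fnext. Qed.

Lemma snub_xV e : E e -> E (F' e).
Proof. by rewrite !inE fsize_fprev. Qed.

Lemma snub_zz c : z (z c) = c.
Proof. by rewrite /z vprevK edge_flip !vnextK. Qed.

Lemma snub_xz e : E e -> F (z e) = R (F (R (R e))).
Proof.
move=> Ee; rewrite /z -fprev_vnext fprev_triangle ?(snub_triangle (i := 2)) //.
by rewrite -fprev_vnext fprevK.
Qed.

(** Granted the chirality, the third triangle after the hexagon is a centre of threefold rotation,
    and [F (z e)] is one step backwards around it. *)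
Lemma snub_iter_xz k e : (forall e, E e -> E (z e)) -> E e ->
  iter k (fun e => F (z e)) e = R' (R' (R' (iter k F' (R (R (R e)))))).
Proof.
move=> Ez Ee; elim: k => [|k IHk]; first by rewrite !vnextK.
rewrite iterS; set e' := iter k _ e.
have Ee' : E e' by rewrite /e'; elim: (k) => //= l /Ez/snub_x.
rewrite snub_xz // iterS.
have -> : iter k F' (R (R (R e))) = R (R (R e')) by rewrite /e' IHk !vprevK.
by rewrite fprev_vnext snub_vnext.
Qed.

Lemma snub_chiral_site_classes (e0 : D) : E e0 -> (forall e, E e -> E (z e)) ->
  site_classes_at_most M 3.
Proof.
move=> E0 Ez.
apply: (spin_site_classes (K := 5) E0 snub_x Ez) => // [|e i Ee i5||gen] //.
- exact: snub_cycle.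
- by rewrite inE snub_triangle.
- case=> [|[|[|[|[|]]]]] // _.
  + by exists 0 => //; exists [:: true].
  + by exists 2 => //; exists [:: false] => e _ /=; rewrite /z !vprevK.
  + exists 4 => //; exists [:: true; false] => e Ee /=.
    by rewrite snub_xz // -snub_vprev vnextK.
  + exists 3 => //; exists [:: true; false; true; false] => e Ee.
    rewrite -[word _ _ _ _]/(iter 2 (fun c => F (z c)) e) snub_iter_xz //= !vprevK.
    by rewrite fprev2_triangle // (snub_triangle (i := 3)).
  + exists 1 => //; exists (nseq 5 true) => e /eqP e6.
    by rewrite [iter 4 _ _]/= -snub_vprev -vnext_fprev (fprevE e6).
- have triangle i e : E e -> 0 < i < 5 -> fsize (iter i R e) = 3 by apply: snub_triangle.
  apply: (hexagonal_action E0 snub_x Ez) gen => e Ee.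
    split; rewrite ?snub_zz ?snub_iter_xz //; first by rewrite -(eqP Ee) iter_fsize.
    by rewrite -(triangle 3 e Ee isT) iter_fsize_fprev !vnextK.
  split; apply: spin_neq.
  + by apply: (site_iter_fnext (i := 2)); rewrite (eqP Ee).
  + by apply: (site_iter_fnext (i := 3)); rewrite (eqP Ee).
  + rewrite !site_vprev -(site_vnext e).
    by apply: (site_iter_fnext (i := 1)); rewrite (triangle 1).
  + rewrite -[F _]/(iter 1 (fun c => F (z c)) e) snub_iter_xz // !site_vprev.
    rewrite -(site_iter_vnext 3 e).
    by apply: (site_iter_fprev (i := 1)); rewrite (triangle 3).
Qed.

(* The third vertex of the triangle next to a hexagon sees it as its second or
   third triangle. *)
Lemma snub_chirality e : E e -> ~~ E (z e) -> E (R (R (F (R e)))).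
Proof.
move=> Ee; have [_ [i i5 /eqP hi] _] := typeM (F (R e)).
have d1 : fsize (R e) = 3 by apply: (snub_triangle (i := 1)).
case: i i5 hi => [|[|[|[|[|]]]]] //= _.
- by rewrite fsize_fnext d1.
- rewrite -fsize_vprev_fnext -fprev_triangle // fprev_vnext 2!snub_vprev snub_cycle.
  by rewrite (snub_triangle (snub_x Ee) (i := 3)).
- by rewrite /z 2!snub_vprev snub_cycle => -> .
- by rewrite -snub_vprev -fprev_vnext fsize_fprev (snub_triangle (i := 2)).
Qed.

Lemma snub_fprev e : E e -> F (R (F' e)) = F' (R' e).
Proof.
move=> Ee; rewrite vnext_fprev -fprev_triangle //.
by rewrite snub_vprev (snub_triangle (i := 4)).
Qed.

(** Were the chiralities at [e] and [F' e] different, they would produce hexagon corners [e1] and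
    [e2] at the other two vertices of the triangle of [R (R (R e))]. Then [F' e2], in a hexagon,
    would be the second triangle corner after [e1]. *)
Lemma snub_chirality_fprev e : E e -> E (z e) -> E (z (F' e)).
Proof.
move=> Ee Eze; apply: contraT => /(snub_chirality (snub_xV Ee)).
rewrite snub_fprev // => EB.
have d3 : fsize (R (R (R e))) = 3 by apply: (snub_triangle (i := 3)).
pose e1 := F (z e); have Ee1 : E e1 by apply: snub_x.
have e1P : F' (R (R (R e))) = R (R (R e1)).
  by rewrite /e1 snub_xz // fprev_vnext snub_vprev.
pose e2 := R (F (R (R (R e)))).
have Ee2 : E e2.
  by move: EB; rewrite (snub_vprev e) fprev_vnext vprevK.
have : R (R (R e1)) = R (F' e2).
  rewrite -e1P fprev_triangle // vnext_fprev /e2 vnextK //.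
move=> /spin_injective e12; have := snub_triangle (i := 2) Ee1 isT.
by rewrite /= e12 fsize_fprev (eqP Ee2).
Qed.

Lemma snub_chirality_fnext e : E e -> E (z e) -> E (z (F e)).
Proof.
move=> Ee Eze.
have iterP k : E (iter k F' e) /\ E (z (iter k F' e)).
  elim: k => //= k [IH1 IH2]; split; first exact: snub_xV.
  exact: snub_chirality_fprev.
have -> : F e = iter 5 F' e; last by case: (iterP 5).
by have := iter_fsize_fprev (F e); rewrite fsize_fnext (eqP Ee) iterSr fnextK => ->.
Qed.

(** Chirality is constant along a hexagon, and [z], being an involution, carries it to other
    hexagons; connectedness spreads it from one corner to all. The second alternative is the first
    for the mirror image. *)
Lemma snub_dichotomy :
  (forall e, E e -> E (z e)) \/ (forall e, E e -> E (R (R (F' (R' e))))).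
Proof.
case: (boolP [exists e, E e && E (z e)]) => [/existsP[e0 /andP[E0 Ez0]]|nEz]; last first.
  right=> e Ee; rewrite -snub_fprev //; apply: snub_chirality; first exact: snub_xV.
  apply: contra nEz => Ez; apply/existsP; exists (F' e).
  by apply/andP; split=> //; apply: snub_xV.
left.
(* [S c]: the hexagon corner at the site of [c] has the good chirality. *)
pose S c := exists i e, [/\ i < 5, E e, E (z e) & c = iter i R e].
have allS : forall c, S c.
  apply: (@corner_connected M S e0).
  - by exists 0, e0.
  - move=> _ [i [e [i5 Ee Eze ->]]].
    have EzF : E (z (F' e)) by apply: snub_chirality_fprev.
    case: i i5 => [|[|[|[|[|]]]]] // _.
    + exists 0, (F e); split=> //; first exact: snub_x.
      exact: snub_chirality_fnext.
    + by exists 2, (z e); split; rewrite ?snub_zz //= /z !vprevK.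
    + exists 4, (F (z e)); split=> //; first exact: snub_x.
        by apply: snub_chirality_fnext; rewrite ?snub_zz.
      by rewrite snub_xz // [RHS]/= -snub_vprev vnextK.
    + exists 3, (z (F' e)); split; rewrite ?snub_zz ?snub_xV //=.
      rewrite /z !vprevK snub_fprev // vnext_fprev.
      by rewrite 2!snub_vprev snub_cycle.
    + exists 1, (F' e); split=> //; first exact: snub_xV.
      by rewrite [iter 4 _ _]/= -snub_vprev -vnext_fprev.
  - move=> _ [i [e [i5 Ee Eze ->]]].
    move: i5; rewrite leq_eqVlt => /predU1P[i4|i5]; last by exists i.+1, e.
    by exists 0, e; split; rewrite // -iterS i4 /= snub_cycle.
move=> e Ee; have [[|i] [e1 [i5 Ee1 Eze1 eE]]] := allS e; first by rewrite eE.
by have := snub_triangle (i := i.+1) Ee1 i5; rewrite -eE (eqP Ee).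
Qed.
End Snub.

Lemma mirror_snub_type M : snub_type M -> snub_type (mirror M).
Proof.
move=> typeM c.
have vprev4 := snub_vprev typeM; have cyc := snub_cycle typeM.
have iter_vprev i c' : i <= 5 -> iter i (@vprev M) c' = iter (5 - i) (@vnext M) c'.
  by move: i => [|[|[|[|[|[|]]]]]] //= _; rewrite ?vprev4 ?cyc.
have [c5 [i i5 ci] c6] := typeM c; split.
- by rewrite [LHS](iter_vprev 5).
- exists (if i == 0 then 0 else 5 - i).
    by case: ifP => // /negbT; rewrite -lt0n => i0; rewrite ltn_subrL i0.
  case: (posnP i) ci => [-> // | i0 ci]. 
  by rewrite [iter _ _ _]iter_vprev ?leq_subr // subKn ?(ltnW i5).
- move=> /c6 tri i' /andP[i0 i5']; rewrite [iter _ _ _]iter_vprev ?(ltnW i5') //.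
  by rewrite /= tri // subn_gt0 i5' ltn_subrL i0.
Qed.

Lemma has_type_snub M : has_type M [:: 3; 3; 3; 3; 6] -> snub_type M.
Proof.
move=> typeM c; have cyc c' := type_iter_vnext c' typeM.
have := cyc; rewrite /= => cyc5.
have [i [e [i5 ->]]] := typeM c.
case: i i5 => [|[|[|[|[|]]]]] //= _ [] [] [e0 e1 e2 e3 e4] /= _;
  (split; [by rewrite !cyc5 | | by
     rewrite ?e0 ?e1 ?e2 ?e3 ?e4 // => _ [|[|[|[|[|?]]]]] //= _; rewrite ?cyc5]);
  first [by exists 0; rewrite /= ?cyc5 | by exists 1; rewrite /= ?cyc5
    | by exists 2; rewrite /= ?cyc5 | by exists 3; rewrite /= ?cyc5
    | by exists 4; rewrite /= ?cyc5].
Qed.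

Lemma site_classes_3333_6 M (c : corner M) : has_type M [:: 3; 3; 3; 3; 6] ->
  site_classes_at_most M 3.
Proof.
move=> /has_type_snub typeM.
have [e0 E0] : exists e : corner M, fsize e == 6.
  by have [_ [i _ /eqP ci] _] := typeM c; exists (iter i (@vnext M) c).
have [Ez|Ez] := snub_dichotomy typeM; first exact: (snub_chiral_site_classes typeM E0 Ez).
apply: mirror_site_classes.
exact: (snub_chiral_site_classes (mirror_snub_type typeM) E0 Ez).
Qed.

(** * The corners of an oriented polyhedral map *)

Section OrientedMap.
Variable X : polyhedral_map.
Variable o : face X -> bool.
Hypothesis oP : forall f g u v,
  f != g -> ~~ (directed_edge o f u v && directed_edge o g u v).
Implicit Types (u v : vertex X) (f g : face X).

Definition oboundary f := if o f then rev (boundary f) else boundary f.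

Lemma oboundary_uniq f : uniq (oboundary f).
Proof.
by have [_ uf] := face_polygon f; rewrite /oboundary; case: ifP; rewrite ?rev_uniq.
Qed.

Lemma size_oboundary f : size (oboundary f) = size (boundary f).
Proof. by rewrite /oboundary; case: ifP; rewrite ?size_rev. Qed.

Lemma mem_oboundary f u : (u \in oboundary f) = (u \in boundary f).
Proof. by rewrite /oboundary; case: ifP; rewrite ?mem_rev. Qed.

Lemma directed_edgeE f u v :
  directed_edge o f u v = (u \in boundary f) && (next (oboundary f) u == v).
Proof. by rewrite /directed_edge -/(oboundary f) mem_oboundary. Qed.

Lemma set2_inj (T : finType) (u v w t : T) : [set u; v] = [set w; t] ->
  u = w /\ v = t \/ u = t /\ v = w.
Proof.
move=> uv_wt; have: u \in [set w; t] by rewrite -uv_wt set21.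
have: v \in [set w; t] by rewrite -uv_wt set22.
have: w \in [set u; v] by rewrite uv_wt set21.
have: t \in [set u; v] by rewrite uv_wt set22.
by rewrite !inE => /orP[]/eqP? /orP[]/eqP? /orP[]/eqP? /orP[]/eqP?; subst; auto.
Qed.

Lemma face_edgesE f u v :
  ([set u; v] \in face_edges f) = directed_edge o f u v || directed_edge o f v u.
Proof.
have uf := (face_polygon f).2.
have nextE w : next (oboundary f) w = if o f then prev (boundary f) w else next (boundary f) w.
  by rewrite /oboundary; case: ifP => // _; rewrite next_rev.
rewrite !directed_edgeE !nextE; apply/imsetP/idP => [[w wf]|].
  case: ifP => _ /set2_inj[] [-> ->]; rewrite ?mem_next ?wf ?prev_next ?eqxx ?orbT //.
case: ifP => _ /orP[] /andP[wf /eqP <-].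
- by exists (prev (boundary f) u); rewrite ?mem_prev // next_prev // setUC.
- by exists (prev (boundary f) v); rewrite ?mem_prev // next_prev.
- by exists u.
- by exists v; rewrite // setUC.
Qed.

Lemma iter_next_neq (T : finType) (p : seq T) x i : uniq p -> x \in p ->
  0 < i < size p -> iter i (next p) x != x.
Proof.
move=> Up px; rewrite -(order_cycle (cycle_next Up) Up px).
move=> /andP[i0 /findex_iter fi]; apply: contraTneq i0 => ici.
by move: fi; rewrite ici => <-; rewrite lt0n findex_eq0 eqxx.
Qed.

Definition mcorner := {p : vertex X * face X | p.1 \in boundary p.2}.
Implicit Types c : mcorner.
Definition csite c : vertex X := (val c).1.
Definition cface c : face X := (val c).2.

Lemma corner_inj c c' : csite c = csite c' -> cface c = cface c' -> c = c'.
Proof.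
move: c c' => [[u f] uf] [[v g] vg]; rewrite /csite /cface /= => uv fg.
by apply: val_inj; rewrite /= uv fg.
Qed.

Lemma csite_mem c : csite c \in oboundary (cface c).
Proof. by rewrite mem_oboundary (valP c). Qed.

Lemma cnext_subproof c : next (oboundary (cface c)) (csite c) \in boundary (cface c).
Proof. by rewrite -mem_oboundary mem_next csite_mem. Qed.

Lemma cprev_subproof c : prev (oboundary (cface c)) (csite c) \in boundary (cface c).
Proof. by rewrite -mem_oboundary mem_prev csite_mem. Qed.

Definition cnext c : mcorner :=
  Sub (next (oboundary (cface c)) (csite c), cface c) (cnext_subproof c).
Definition cprev c : mcorner :=
  Sub (prev (oboundary (cface c)) (csite c), cface c) (cprev_subproof c).

Lemma cnextK : cancel cnext cprev.
Proof. by move=> c; apply: corner_inj; rewrite //= /csite /= prev_next ?oboundary_uniq. Qed.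

Lemma cprevK : cancel cprev cnext.
Proof. by move=> c; apply: corner_inj; rewrite //= /csite /= next_prev ?oboundary_uniq. Qed.

Lemma iter_cnext c i :
  csite (iter i cnext c) = iter i (next (oboundary (cface c))) (csite c) /\
  cface (iter i cnext c) = cface c.
Proof. by elim: i => //= i [IH1 IH2]; rewrite /csite /cface /= IH1 IH2. Qed.

Definition csize c := size (boundary (cface c)).

Lemma iter_csize c : iter (csize c) cnext c = c.
Proof.
have [s f] := iter_cnext c (csize c); apply: corner_inj => //.
rewrite s /csize -size_oboundary.
rewrite -(order_cycle (cycle_next (oboundary_uniq _)) (oboundary_uniq _) (csite_mem c)).
exact: (fingraph.iter_order (can_inj (prev_next (oboundary_uniq _)))).
Qed.

Lemma csite_iter_cnext c i : 0 < i < csize c -> csite (iter i cnext c) != csite c.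
Proof.
have [-> _] := iter_cnext c i; rewrite /csize -size_oboundary.
by apply: iter_next_neq; rewrite ?oboundary_uniq ?csite_mem.
Qed.

Lemma directed_edge_corner c : directed_edge o (cface c) (csite c) (csite (cnext c)).
Proof. by rewrite directed_edgeE (valP c) /=. Qed.

Lemma directed_edge_inj c c' : csite c = csite c' -> csite (cnext c) = csite (cnext c') ->
  c = c'.
Proof.
move=> s s'; apply: corner_inj => //; apply/eqP/negPn/negP.
move=> /(oP (csite c) (csite (cnext c))) /negP[].
by rewrite directed_edge_corner s s' directed_edge_corner.
Qed.

Lemma directed_edgeP f u v : directed_edge o f u v ->
  exists c, [/\ cface c = f, csite c = u & csite (cnext c) = v].
Proof.
rewrite directed_edgeE => /andP[uf /eqP <-].
by exists (Sub (u, f) uf).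
Qed.

(** The edge lies on a second face, which the orientation forces to run along it backwards. *)
Lemma opposite_exists c :
  exists c', csite c' = csite (cnext c) /\ csite (cnext c') = csite c.
Proof.
set e := [set csite c; csite (cnext c)].
have ef : e \in face_edges (cface c) by rewrite face_edgesE directed_edge_corner.
have /edge_two_faces two : e \in edges X by apply/bigcupP; exists (cface c).
have /card_gt0P[g] : 0 < #|[set f | e \in face_edges f] :\ cface c|.
  by move: two; rewrite (cardsD1 (cface c)) inE ef => -[]; rewrite add0n => ->.
rewrite !inE => /andP[gf]; rewrite face_edgesE => /orP[gc|/directed_edgeP[c' [_ s s']]].
  have := oP (csite c) (csite (cnext c)) gf.
  by rewrite gc directed_edge_corner.
by exists c'.
Qed.

(** The default is never reached, by [opposite_exists]. *)
Definition cflip c : mcorner :=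
  odflt c [pick c' | (csite c' == csite (cnext c)) && (csite (cnext c') == csite c)].

Lemma cflipP c : csite (cflip c) = csite (cnext c) /\ csite (cnext (cflip c)) = csite c.
Proof.
rewrite /cflip; case: pickP => [c' /andP[/eqP ? /eqP ?] //|none].
have [c' [s s']] := opposite_exists c.
by have := none c'; rewrite /= s s' !eqxx.
Qed.

Lemma cflipK : involutive cflip.
Proof.
move=> c; have [s s'] := cflipP c; have [t t'] := cflipP (cflip c).
by apply: directed_edge_inj; rewrite ?t ?t'.
Qed.

Definition cspin c := cnext (cflip c).
Definition cspinV c := cflip (cprev c).

Lemma cspinK : cancel cspin cspinV.
Proof. by move=> c; rewrite /cspin /cspinV cnextK cflipK. Qed.

Lemma cspinVK : cancel cspinV cspin.
Proof. by move=> c; rewrite /cspin /cspinV cflipK cprevK. Qed.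

Lemma csite_cspin c : csite (cspin c) = csite c.
Proof. by have [] := cflipP c. Qed.

Lemma cspin_flip c : cnext (cspinV (cnext c)) = cspin c.
Proof. by rewrite /cspinV cnextK. Qed.

Lemma cspin_unique c c' : csite c' = csite c -> csite (cprev c') = csite (cnext c) ->
  cspin c = c'.
Proof.
move=> s s'; rewrite -(cprevK c'); congr cnext; have [t t'] := cflipP c.
by apply: directed_edge_inj; rewrite ?t ?t' ?cprevK.
Qed.

(** The faces run along the common edge in opposite directions: one leaves the site by it, the other
    arrives. *)
Lemma share_edge_spin c c' : csite c = csite c' -> cface c != cface c' ->
  share_edge_at (csite c) (cface c) (cface c') -> cspin c = c' \/ cspin c' = c.
Proof.
move=> s ff' /existsP[e /andP[]]; rewrite inE => /andP[ef ef'] ue.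
have [v eE] : exists v, e = [set csite c; v].
  move: (ef) ue => /imsetP[w wf ->]; rewrite !inE => /orP[]/eqP->; last first.
    by exists w; rewrite setUC.
  by exists (next (boundary (cface c)) w).
have next_of c1 w : directed_edge o (cface c1) (csite c1) w -> csite (cnext c1) = w.
  by rewrite directed_edgeE => /andP[_ /eqP].
have prev_of c1 w : directed_edge o (cface c1) w (csite c1) -> csite (cprev c1) = w.
  rewrite directed_edgeE => /andP[_ /eqP sw].
  by rewrite /csite /= -/(csite c1) -sw prev_next ?oboundary_uniq.
move: ef ef'; rewrite eE !face_edgesE => /orP[] d /orP[] d'.
- by have := oP (csite c) v ff'; rewrite d d'.
- by left; apply: cspin_unique; rewrite ?(next_of c v) ?(prev_of c' v) -?s.
- by right; apply: cspin_unique; rewrite ?(next_of c' v) ?(prev_of c v) -?s.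
- by have := oP v (csite c) ff'; rewrite d d'.
Qed.

Section Listing.
Variables (T : finType) (f : T -> T) (p : seq T).
Hypotheses (f_inj : injective f) (Up : uniq p) (p3 : 2 < size p).
Hypothesis p_cycle : path.cycle (fun x y => (f x == y) || (f y == x)) p.

(** The direction cannot turn round: two neighbours of an element of [p] would have the same image
    under [f], hence coincide, although [p] has at least three distinct elements. *)
Lemma unoriented_fcycle : fcycle f p \/ fcycle f (rev p).
Proof.
have stepP x : x \in p -> f x = next p x \/ f (next p x) = x.
  by move=> /(next_cycle p_cycle)/orP[] /eqP; auto.
case: (boolP (has (fun x => f x == next p x) p)) => [/hasP[x0 px0 /eqP fx0]|none].
  left; have fn x : x \in p -> f x = next p x.
    rewrite -(fconnect_cycle (cycle_next Up) px0) => /iter_findex <-.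
    elim: (findex _ _ _) => // n IHn.
    have px k : iter k (next p) x0 \in p.
      by rewrite -(fconnect_cycle (cycle_next Up) px0) fconnect_iter.
    case: (stepP _ (px n.+1)) => //= back.
    have /eqP[] := iter_next_neq (i := 2) Up (px n) p3.
    by apply: f_inj; rewrite IHn.
  apply: (sub_in_cycle (P := mem p)) (cycle_next Up).
    by move=> x y px _ /eqP <-; rewrite /= fn.
  exact/allP.
right; rewrite rev_cycle.
apply: (sub_in_cycle (P := mem p)) (cycle_next Up); last exact/allP.
move=> x y px _ /eqP <-; case: (stepP x px) => /= [fx|->] //.
by case/hasP: none; exists x; rewrite ?fx.
Qed.
End Listing.

Lemma fcycle_traject (T : finType) (f : T -> T) (x : T) p : uniq (x :: p) -> fcycle f (x :: p) ->
  x :: p = traject f x (size p).+1.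
Proof.
move=> Up fp; have := fingraph.orbitE fp Up (mem_head x p).
by rewrite /= eqxx rot0 /fingraph.orbit (order_cycle fp Up (mem_head x p)).
Qed.

(** A face-cycle comes without direction; passing to corners, and reversing it if necessary, makes
    it a cycle of [cspin]. *)
Lemma corner_listing u cs : face_cycle u cs -> exists L : seq mcorner,
  [/\ uniq L, fcycle cspin L, (forall c, csite c = u -> c \in L) &
   let s := [seq size (boundary f) | f <- cs] in
   [seq csize c | c <- L] = s \/ [seq csize c | c <- L] = rev s].
Proof.
move=> [cs3 Ucs mem_cs cycle_cs].
have [f0 f0cs] : exists f0, f0 \in cs.
  by case: cs cs3 {Ucs mem_cs cycle_cs} => // f0 cs _; exists f0; rewrite mem_head.
have uf0 : u \in boundary f0 by move: f0cs; rewrite mem_cs.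
pose c0 : mcorner := Sub (u, f0) uf0.
pose K f := insubd c0 (u, f).
have KE f : f \in cs -> csite (K f) = u /\ cface (K f) = f.
  rewrite mem_cs inE => uf; rewrite /csite /cface /K.
  by have -> : val (insubd c0 (u, f)) = (u, f) by apply: insubdK.
have K_inj : {in cs &, injective K}.
  by move=> f g /KE[_ {2}<-] /KE[_ {2}<-] ->.
have UK : uniq (map K cs) by rewrite map_inj_in_uniq.
have cycleK : path.cycle (fun x y => (cspin x == y) || (cspin y == x)) (map K cs).
  rewrite cycle_map; apply: (sub_in_cycle (P := mem cs)) (cycle_next Ucs); last exact/allP.
  move=> f g fcs _ /eqP <- {g}; set g := next cs f.
  have gcs : g \in cs by rewrite mem_next.
  have [[s1 f1] [s2 f2]] := (KE f fcs, KE g gcs).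
  rewrite /=; have [|||->|->] := @share_edge_spin (K f) (K g); rewrite ?s1 ?s2 ?f1 ?f2 //=.
  - by rewrite eq_sym; apply: (iter_next_neq (i := 1) Ucs fcs (ltnW cs3)).
  - exact: next_cycle.
  - by rewrite eqxx.
  - by rewrite eqxx orbT.
have mem_L c : csite c = u -> c \in map K cs.
  move=> cu; have cf : cface c \in cs by rewrite mem_cs inE -cu (valP c).
  apply/mapP; exists (cface c) => //; have [s f] := KE _ cf.
  by apply: corner_inj; rewrite ?s ?f.
have sizeL : [seq csize c | c <- map K cs] = [seq size (boundary f) | f <- cs].
  by rewrite -map_comp; apply/eq_in_map => f /KE[_ fE]; rewrite /= /csize fE.
have [|fK|fK] := unoriented_fcycle (can_inj cspinK) UK _ cycleK; first by rewrite size_map.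
  by exists (map K cs); split; auto.
exists (rev (map K cs)); split; rewrite ?rev_uniq //; last by right; rewrite map_rev sizeL.
by move=> c /mem_L; rewrite mem_rev.
Qed.

Lemma cspin_connected c c' : csite c = csite c' -> exists i, c' = iter i cspin c.
Proof.
move=> cc'; have [cs /corner_listing[L [UL fL memL _]]] := vertex_face_cycle (csite c).
have := memL c' (esym cc'); rewrite -(fconnect_cycle fL (memL c erefl)).
by move=> /iter_findex <-; exists (findex cspin c c').
Qed.

Lemma oriented_connected (conn : connected_map X) (S : mcorner -> Prop) c : S c ->
  (forall c, S c -> S (cnext c)) -> (forall c, S c -> S (cspin c)) -> forall c, S c.
Proof.
move=> Sc SF SR.
have Sprev := closed_inverse cnextK SF.
have Ssite c1 c2 : csite c1 = csite c2 -> S c1 -> S c2.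
  by move=> /cspin_connected[i ->] Sc1; elim: i => //= i; apply: SR.
have step u v : adjacent u v -> (forall c, csite c = u -> S c) -> forall c, csite c = v -> S c.
  move=> /bigcupP[f _]; rewrite face_edgesE => /orP[] /directed_edgeP[c1 [_ s s']] Su c2 c2v.
    by apply: (Ssite (cnext c1)); [rewrite s' | apply: SF; apply: Su].
  apply: (Ssite c1); first by rewrite s.
  by rewrite -(cnextK c1); apply: Sprev; apply: Su.
move=> c'; have /connectP[p pP lastE] := conn.2 (csite c) (csite c').
have Sc0 c1 : csite c1 = csite c -> S c1 by move=> /esym/Ssite; apply.
move: {c} (csite c) Sc0 pP lastE {Sc} => u Su.
elim: p u Su => [|v p IHp] u Su /=; first by move=> _ c'u; apply: Su.
by move=> /andP[uv pP] lastE; apply: (IHp v) => //; apply: step uv Su.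
Qed.

Definition oriented_map (conn : connected_map X) : corner_map :=
  @CornerMap _ (vertex X) cnext cprev cspin cspinV csite csize cnextK cprevK
  cspinK cspinVK cspin_flip csite_cspin csite_iter_cnext iter_csize (fun _ => erefl)
  (oriented_connected conn).

Lemma oriented_has_type (conn : connected_map X) t :
  semi_equivelar_of_type X t -> has_type (oriented_map conn) (polygons t).
Proof.
move=> [_ typeX] c; have [cs /corner_listing[L [UL fL memL sizeL]] csE] := typeX (csite c).
rewrite /= csE in sizeL.
have cL := memL c erefl.
case: L UL fL memL cL sizeL => // e L UL fL memL cL sizeL.
have eL := fcycle_traject UL fL.
have sz : size (polygons t) = (size L).+1.
  by case: sizeL => /(congr1 size) /=; rewrite ?size_rev size_map => ->.
have readsE : [seq csize c | c <- e :: L] = [seq csize (iter i cspin e) | i <- iota 0 (size L).+1].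
  rewrite eL; apply: (@eq_from_nth _ 0); rewrite ?size_map ?size_traject ?size_iota // => i iL.
  by rewrite (nth_map e) ?size_traject // (nth_map 0) ?size_iota // nth_iota // nth_traject.
have iter_e : iter (size L).+1 cspin e = e.
  rewrite -[(size L).+1]/(size (e :: L)) -(order_cycle fL UL (mem_head e L)).
  exact: (fingraph.iter_order (can_inj cspinK)).
exists (index c (e :: L)), e; split.
- by rewrite sz -/(size (e :: L)) index_mem.
- rewrite -{1}(nth_index e cL) {1}eL nth_traject //.
  by rewrite -/(size (e :: L)) index_mem.
- by rewrite /reads size_rev sz; case: sizeL => sizeE; [left | right];
    split=> //; rewrite -readsE.
Qed.

(** * From symmetries of the corners to automorphisms of the map *)

Section Automorphism.
Variables (conn : connected_map X) (h : mcorner -> mcorner).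
Hypothesis symh : @symmetry (oriented_map conn) h.

Lemma symmetry_iter_cnext i c : h (iter i cnext c) = iter i cnext (h c).
Proof. by have [hF _] := symh; elim: i => //= i <-; apply: hF. Qed.

Lemma symmetry_csite c c' : csite c = csite c' -> csite (h c) = csite (h c').
Proof.
move=> /cspin_connected[i ->]; elim: i => //= i ->.
by have [_ hR] := symh; rewrite [h (cspin _)]hR /= csite_cspin.
Qed.

Lemma corner_of_vertex u : exists c, csite c = u.
Proof.
have [cs [cs3 _ memcs _]] := vertex_face_cycle u.
case: cs cs3 memcs => // f cs _ memcs; have := memcs f; rewrite mem_head inE => /esym uf.
by exists (Sub (u, f) uf).
Qed.

Lemma corner_of_face f : exists c, cface c = f.
Proof.
have [f3 _] := face_polygon f; case fE: (boundary f) f3 => [|u p] // _.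
have uf : u \in boundary f by rewrite fE mem_head.
by exists (Sub (u, f) uf).
Qed.

Lemma symmetry_surj c : exists c', h c' = c.
Proof.
have [hF hR] := symh.
apply: (@oriented_connected conn (fun c => exists c', h c' = c) (h c)) => [|c1 [c2 <-]|c1 [c2 <-]].
- by exists c.
- by exists (cnext c2); apply: hF.
- by exists (cspin c2); apply: hR.
Qed.

Lemma face_edges_corners f :
  face_edges f = [set [set csite c; csite (cnext c)] | c in [pred c | cface c == f]].
Proof.
apply/setP => e; apply/idP/imsetP => [ef | [c /eqP<- ->]]; last first.
  by rewrite face_edgesE directed_edge_corner.
have /imsetP[u uf eE] := ef.
move: ef; rewrite eE face_edgesE => /orP[] /directed_edgeP[c [cf s s']].
  by exists c; rewrite ?inE ?cf // s s'.
by exists c; rewrite ?inE ?cf // s s' setUC.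
Qed.

Lemma same_face c c' : cface c = cface c' -> exists i, c' = iter i cnext c.
Proof.
move=> ff'; have := csite_mem c'; rewrite -ff'.
rewrite -(fconnect_cycle (cycle_next (oboundary_uniq _)) (csite_mem c)) => /iter_findex iE.
set i := findex _ _ _ in iE; exists i; have [s f] := iter_cnext c i.
by apply: corner_inj; rewrite ?s ?f.
Qed.

Lemma symmetry_automorphism :
  exists2 s : {perm vertex X}, s \in Aut_map X & forall c, s (csite c) = csite (h c).
Proof.
have [hF _] := symh.
have /fin_all_exists[s0 s0P] u : exists v, forall c, csite c = u -> csite (h c) = v.
  have [c0 <-] := corner_of_vertex u.
  by exists (csite (h c0)) => c /symmetry_csite.
have s0E c : s0 (csite c) = csite (h c) by apply/esym/s0P.
have s0_inj : injective s0.
  (* On a finite set a right inverse is injective, hence bijective, so surjectivity of [s0] gives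
     injectivity. *)
  have /fin_all_exists[g s0g] v : exists u, s0 u = v.
    have [c <-] := corner_of_vertex v; have [c' <-] := symmetry_surj c.
    by exists (csite c').
  have [g' gK g'K] := injF_bij (can_inj s0g).
  by apply: (eq_inj (can_inj g'K)) => u; rewrite -{2}(g'K u) s0g.
pose s := perm s0_inj.
have sE c : s (csite c) = csite (h c) by rewrite permE.
have pres_s : preserves_map s.
  have pres_f f : exists g, [set s @: (e : {set vertex X}) | e in face_edges f] = face_edges g.
    have [c cf] := corner_of_face f; exists (cface (h c)).
    have sedge c' : s @: [set csite c'; csite (cnext c')] =
        [set csite (h c'); csite (cnext (h c'))].
      by rewrite imsetU1 imset_set1 !sE [h (cnext _)]hF.
    have hface c' : cface c' = f -> cface (h c') = cface (h c).
      by rewrite -cf => /esym/same_face[i ->]; rewrite symmetry_iter_cnext (iter_cnext _ _).2.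
    rewrite !face_edges_corners; apply/setP => e; apply/imsetP/imsetP.
      move=> [_ /imsetP[c' /eqP c'f ->] ->]; exists (h c'); last exact: sedge.
      by rewrite inE hface.
    move=> [c1 /eqP/esym/same_face[i c1E] ->].
    exists [set csite (iter i cnext c); csite (cnext (iter i cnext c))].
      by apply/imsetP; exists (iter i cnext c); rewrite // inE (iter_cnext _ _).2 cf.
    by rewrite sedge symmetry_iter_cnext c1E.
  apply/andP; split; last first.
    by apply/forallP => f; apply/existsP; have [g /eqP gE] := pres_f f; exists g.
  apply/forall_inP => e /bigcupP[f _ ef]; have [g gE] := pres_f f.
  by apply/bigcupP; exists g; rewrite // -gE imset_f.
exists s => //; rewrite inE pres_s /=.
(* The inverse is a power of [s], so it preserves the map too. *)
have -> : (s^-1 = s ^+ #[s].-1)%g by rewrite invg_expg.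
elim: (_.-1) => [|n IHn]; first by rewrite expg0 preserves_map1.
by rewrite expgS preserves_mapM.
Qed.
End Automorphism.

Lemma vertex_orbits_le (conn : connected_map X) n :
  site_classes_at_most (oriented_map conn) n -> #|vertex_orbits X| <= n.
Proof.
move=> [L Ln LP]; apply: leq_trans Ln.
pose Lo := [seq orbit 'P (Aut_map X) (csite c) | c <- L].
rewrite -(size_map (fun c => orbit 'P (Aut_map X) (csite c))) -/Lo.
apply: leq_trans (card_size Lo); apply/subset_leq_card/subsetP => _ /imsetP[u _ ->].
have [c <-] := corner_of_vertex u.
have [e Le [h symh he]] := LP c; have [s As sE] := symmetry_automorphism symh.
apply/mapP; exists e => //; apply/orbit_eqP.
have <- : s (csite e) = csite c by rewrite sE; apply: he.
exact: (mem_orbit 'P).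
Qed.
End OrientedMap.

Theorem theorem1p7 (X : polyhedral_map) (m : nat) :
  on_torus X -> semi_equivelar X -> #|vertex_orbits X| = m ->
  [/\ semi_equivelar_of_type X [:: (4, 1); (8, 2)] -> m <= 2,
      [\/ semi_equivelar_of_type X [:: (3, 4); (6, 1)],
          semi_equivelar_of_type X [:: (3, 1); (4, 1); (6, 1); (4, 1)]
        | semi_equivelar_of_type X [:: (3, 1); (12, 2)]] -> m <= 3
    & semi_equivelar_of_type X [:: (4, 1); (6, 1); (12, 1)] -> m <= 6].
Proof.
move=> [conn [o oP] _] _ <-.
have [c _] : exists c : mcorner X, True.
  have /card_gt0P[u _] := conn.1.
  by have [c _] := corner_of_vertex u; exists c.
pose M := oriented_map oP conn.
have typeP t := @oriented_has_type X o oP conn t.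
have le n := @vertex_orbits_le X o oP conn n.
split=> [/typeP T | [/typeP T|/typeP T|/typeP T] | /typeP T]; apply: le.
- exact: (@site_classes_4_8_8 M c T).
- exact: (@site_classes_3333_6 M c T).
- exact: (@site_classes_3_4_6_4 M T c).
- exact: (@site_classes_3_12_12 M c T).
- exact: (@site_classes_4_6_12 M T c).
Qed.
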